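(* Let $\{\mathcal{H};\mathcal{E}=\{\mathcal{H}_\iota\}_{\iota\in\Omega};\mathcal{D}_{\mathcal{E}}\}$ be a commutative quantized domain with $\mathcal{E}$ upward filtered and such that $C^*(\mathcal{D}_{\mathcal{E}})$ is an injective local operator space. Let $\mathcal{V}\subseteq C^*(\mathcal{D}_{\mathcal{E}})$ be a unital local operator space such that $\overline{b(\mathcal{V})}=\mathcal{V}$ (closure in $C^*(\mathcal{D}_{\mathcal{E}})$). Then $b(\mathcal{I}_{\mathcal{R}}(\mathcal{V}))=\mathcal{I}_{\mathcal{R}}(b(\mathcal{V}))$, up to a unital complete order $\mathcal{R}$-isomorphism, where $\mathcal{I}_{\mathcal{R}}(\mathcal{V})$ is the injective $\mathcal{R}$-envelope of the unital local operator space $\mathcal{V}$ and $\mathcal{I}_{\mathcal{R}}(b(\mathcal{V}))$ is the injective $\mathcal{R}$-envelope of the unital operator space $b(\mathcal{V})\subseteq b(C^*(\mathcal{D}_{\mathcal{E}}))$.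
   Context: Locally $C^*$-algebras: a $C^*$-seminorm on a unital $*$-algebra is a seminorm $p$ with $p(1)=1$, $p(ab)\le p(a)p(b)$, $p(a^* )=p(a)$, $p(a^*a)=p(a)^2$. A locally $C^*$-algebra $\mathcal{A}$ is a complete Hausdorff topological $*$-algebra over $\mathbb{C}$ whose topology is given by a family $\{p_\lambda\}_{\lambda\in\Lambda}$ of $C^*$-seminorms, $\Lambda$ a directed poset and $p_{\lambda_1}\le p_{\lambda_2}$ if $\lambda_1\le\lambda_2$. $M_n(\mathcal{A})$ carries the seminorms $p_\lambda^n([a_{ij}])=\|[a_{ij}+\ker p_\lambda]\|_{M_n(\mathcal{A}/\ker p_\lambda)}$, where $\mathcal{A}/\ker p_\lambda$ is a $C^*$-algebra for the norm induced by $p_\lambda$. The bounded part of $\mathcal{A}$ is the $C^*$-algebra $b(\mathcal{A})=\{a:\|a\|_\infty=\sup_\lambda p_\lambda(a)<\infty\}$; for a subspace $\mathcal{V}\subseteq\mathcal{A}$, $b(\mathcal{V})=\mathcal{V}\cap b(\mathcal{A})$. A unital local operator space is a linear subspace, containing the unit, of a unital locally $C^*$-algebra. For unital local operator spaces $\mathcal{V}\subseteq\mathcal{A}$ (seminorms $\{p_\lambda\}_{\lambda\in\Lambda}$), $\mathcal{W}\subseteq\mathcal{B}$ (seminorms $\{q_\delta\}_{\delta\in\Delta}$), a linear map $\varphi:\mathcal{V}\to\mathcal{W}$ is local completely contractive if for each $\delta\in\Delta$ there is $\lambda\in\Lambda$ with $q_\delta^n([\varphi(a_{ij})])\le p_\lambda^n([a_{ij}])$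 for all $n$ and all $[a_{ij}]\in M_n(\mathcal{V})$; it is local completely isometric if $\Delta=\Lambda$ and $q_\lambda^n([\varphi(a_{ij})])=p_\lambda^n([a_{ij}])$ for all $\lambda,n,[a_{ij}]$. $\mathcal{V}$ is injective if for any unital local operator space $\mathcal{W}$ and unital subspace $\mathcal{W}_0\subseteq\mathcal{W}$, every unital local completely contractive map $\mathcal{W}_0\to\mathcal{V}$ extends to a unital local completely contractive map $\mathcal{W}\to\mathcal{V}$. Quantized domain: $\mathcal{H}$ is a Hilbert space, $\Omega$ a directed poset, $\mathcal{E}=\{\mathcal{H}_\iota\}_{\iota\in\Omega}$ an upward filtered family of nonzero closed subspaces ($\mathcal{H}_{\iota_1}\subseteq\mathcal{H}_{\iota_2}$ if $\iota_1\le\iota_2$) whose union $\mathcal{D}_{\mathcal{E}}=\bigcup_\iota\mathcal{H}_\iota$ is dense in $\mathcal{H}$; $P_\iota$ is the orthogonal projection onto $\mathcal{H}_\iota$; the domain is commutative if the $P_\iota$ mutually commute. $C^*(\mathcal{D}_{\mathcal{E}})$ is the set of linear operators $T:\mathcal{D}_{\mathcal{E}}\to\mathcal{D}_{\mathcal{E}}$ with $P_\iota T\subseteq TP_\iota$ and $TP_\iota=P_\iota TP_\iota\in B(\mathcal{H})$ for all $\iota$; it is a unital locally $C^*$-algebra with involution $T^*=T^{\bigstar}\upharpoonright_{\mathcal{D}_{\mathcal{E}}}$ ($T^{\bigstar}$ the Hilbert space adjoint) and seminorms $\|T\|_\iota=\|T\upharpoonright_{\mathcal{H}_\iota}\|$.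 Its bounded part is identified with the injective von Neumann algebra $\{P_\iota\}_{\iota\in\Omega}'\subseteq B(\mathcal{H})$. $\mathcal{R}$ is the commutative subring of $B(\mathcal{H})$ generated by $\{P_\iota\}_{\iota\in\Omega}\cup\{1_{\mathcal{H}}\}$. A (local) $\mathcal{R}$-module is a unital subspace $\mathcal{W}$ of $C^*(\mathcal{D}_{\mathcal{E}})$ (in the normed case: of $b(C^*(\mathcal{D}_{\mathcal{E}}))$) with $\mathcal{R}\mathcal{W}\subseteq\mathcal{W}$. A linear map $\varphi$ between such modules is an $\mathcal{R}$-map if $\varphi(P_\iota T)=P_\iota\varphi(T)$ for all $\iota,T$. Local case: a local $\mathcal{R}$-extension of $\mathcal{V}$ is a pair $(\mathcal{W},i)$ with $\mathcal{W}\subseteq C^*(\mathcal{D}_{\mathcal{E}})$ a local $\mathcal{R}$-module and $i:\mathcal{V}\to\mathcal{W}$ a unital local completely isometric map; it is $\mathcal{R}$-rigid if $\mathrm{id}_{\mathcal{W}}$ is the only unital local completely contractive $\mathcal{R}$-map $\mathcal{W}\to\mathcal{W}$ extending the identity map on (the copy $i(\mathcal{V})$ of) $\mathcal{V}$. The injective $\mathcal{R}$-envelope $\mathcal{I}_{\mathcal{R}}(\mathcal{V})$ is a local $\mathcal{R}$-rigid extension $(\mathcal{W},i)$ with $\mathcal{W}$ injective (it is unique up to a bijective unital $\mathcal{R}$-map that is local completely isometric together with its inverse). Normed case: for a unital subspace $\mathcal{U}\subseteq b(C^*(\mathcal{D}_{\mathcal{E}}))$, an $\mathcal{R}$-extension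 is a pair $(\mathcal{W},i)$ with $\mathcal{W}\subseteq b(C^*(\mathcal{D}_{\mathcal{E}}))$ an $\mathcal{R}$-module and $i:\mathcal{U}\to\mathcal{W}$ a unital complete isometry; it is rigid if $\mathrm{id}_{\mathcal{W}}$ is the unique completely contractive $\mathcal{R}$-map on $\mathcal{W}$ extending the identity on $i(\mathcal{U})$. The injective $\mathcal{R}$-envelope $\mathcal{I}_{\mathcal{R}}(\mathcal{U})$ is a rigid $\mathcal{R}$-extension $(\mathcal{W},i)$ with $\mathcal{W}$ injective as a unital operator space (unique up to unital complete order $\mathcal{R}$-isomorphism). A unital complete order $\mathcal{R}$-isomorphism between two $\mathcal{R}$-modules in $b(C^*(\mathcal{D}_{\mathcal{E}}))$ is a bijective unital linear map $\varphi$ such that $\varphi$ and $\varphi^{-1}$ are completely isometric $\mathcal{R}$-maps. *)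

(* Defs.v *)
From HB Require Import structures.
From mathcomp Require Import all_boot all_order all_algebra.
From mathcomp Require Import complex.
From mathcomp Require Import all_classical all_reals all_analysis.

Set Implicit Arguments.
Unset Strict Implicit.
Unset Printing Implicit Defensive.

Import Order.TTheory GRing.Theory Num.Theory.
Import numFieldNormedType.Exports.
Local Open Scope classical_set_scope.
Local Open Scope complex_scope.
Local Open Scope ring_scope.

Definition directed d (I : porderType d) : Prop :=
  (exists i : I, True) /\
  forall i j : I, exists k : I, (i <= k)%O /\ (j <= k)%O.

(** * Locally C*-algebras *)

Section LocallyCstar.
Context {R : realType}.

Record is_involution (A : algType R[i]) (star : A -> A) : Prop := {
  starK : forall a, star (star a) = a;
  starD : forall a b, star (a + b) = star a + star b;
  starZ : forall (c : R[i]) a, star (c *: a) = (c^*)%C *: star a;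
  starM : forall a b, star (a * b) = star b * star a }.

(* The scalar action is a parameter because mathcomp's scaling of 'M[A]_n is
   by A, whereas M_n(A) has to be seen as a complex algebra. *)
Record Cstar_seminorm (B : nzRingType) (scale : R[i] -> B -> B)
    (star : B -> B) (p : B -> R) : Prop := {
  csn_triangle : forall a b, p (a + b) <= p a + p b;
  csn_scale : forall c a, p (scale c a) = complex.Re `|c| * p a;
  csn_one : p 1 = 1;
  csn_mul : forall a b, p (a * b) <= p a * p b;
  csn_star : forall a, p (star a) = p a;
  csn_Cstar : forall a, p (star a * a) = p a ^+ 2 }.

(* Matrix seminorms are indexed by n with matrices of size n.+1: all sizes
   n >= 1 are covered. *)
Definition mxnorm (A : Type) := forall n : nat, 'M[A]_n.+1 -> R.

(* q is the norm of the C*-algebra M_n(A / ker p) = M_n(A) / M_n(ker p), pulled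
   back to M_n(A). As A / ker p is a C*-algebra, this determines q. *)
Definition is_matrix_Cstar_seminorm (A : algType R[i]) (star : A -> A)
    (p : A -> R) (n : nat) (q : 'M[A]_n.+1 -> R) : Prop :=
  Cstar_seminorm (fun c => map_mx ( *:%R c)) (fun X => map_mx star X^T) q /\
  forall X, q X = 0 <-> forall i j, p (X i j) = 0.

Record locally_Cstar d (I : porderType d) (A : algType R[i]) (star : A -> A)
    (p : I -> A -> R) (pn : I -> mxnorm A) : Prop := {
  lc_star : is_involution star;
  lc_directed : directed I;
  lc_seminorm : forall l, Cstar_seminorm *:%R star (p l);
  lc_monotone : forall l m, (l <= m)%O -> forall a, p l a <= p m a;
  lc_hausdorff : forall a, (forall l, p l a = 0) -> a = 0;
  lc_complete : forall F : set_system A, ProperFilter F ->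
    (forall l (e : R), 0 < e -> exists a, F [set x | p l (x - a) < e]) ->
    exists a, forall l (e : R), 0 < e -> F [set x | p l (x - a) < e];
  lc_matrix : forall l n, is_matrix_Cstar_seminorm star (p l) (@pn l n) }.

(* A unital C*-algebra: the index set is a singleton, so that the only seminorm
   is a complete norm. *)
Definition is_Cstar_algebra (A : algType R[i]) (star : A -> A)
    (p : A -> R) (pn : mxnorm A) : Prop :=
  @locally_Cstar _ 'I_1 A star (fun=> p) (fun=> pn).

Definition unital_subspace (A : algType R[i]) (V : set A) : Prop :=
  V 1 /\ forall (c : R[i]) a b, V a -> V b -> V (c *: a + b).

(* A linear map V -> W between subspaces V of A and W of B is represented by a
   function A -> B, of which only the values on V matter. *)
Definition linear_between (A B : algType R[i]) (V : set A) (W : set B)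
    (phi : A -> B) : Prop :=
  (forall a, V a -> W (phi a)) /\
  forall (c : R[i]) a b, V a -> V b -> phi (c *: a + b) = c *: phi a + phi b.

Definition mx_in (A : Type) (V : set A) n (X : 'M[A]_n) : Prop :=
  forall i j, V (X i j).

Definition completely_contractive (A B : Type) (p : mxnorm A) (q : mxnorm B)
    (V : set A) (phi : A -> B) : Prop :=
  forall n (X : 'M[A]_n.+1), mx_in V X -> q n (map_mx phi X) <= p n X.

Definition completely_isometric (A B : Type) (p : mxnorm A) (q : mxnorm B)
    (V : set A) (phi : A -> B) : Prop :=
  forall n (X : 'M[A]_n.+1), mx_in V X -> q n (map_mx phi X) = p n X.

Definition local_completely_contractive (I J A B : Type) (p : I -> mxnorm A)
    (q : J -> mxnorm B) (V : set A) (phi : A -> B) : Prop :=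
  forall d : J, exists l : I, completely_contractive (p l) (q d) V phi.

Definition local_completely_isometric (I A B : Type) (p : I -> mxnorm A)
    (q : I -> mxnorm B) (V : set A) (phi : A -> B) : Prop :=
  forall l : I, completely_isometric (p l) (q l) V phi.

Definition injective_local_operator_space (J : Type) (A : algType R[i])
    (q : J -> mxnorm A) (V : set A) : Prop :=
  forall d (I : porderType d) (B : algType R[i]) (star : B -> B)
    (p : I -> B -> R) (pn : I -> mxnorm B), locally_Cstar star p pn ->
  forall W0 W : set B, unital_subspace W0 -> unital_subspace W -> W0 `<=` W ->
  forall phi : B -> A, linear_between W0 V phi -> phi 1 = 1 ->
    local_completely_contractive pn q W0 phi ->
  exists psi : B -> A, [/\ linear_between W V psi, psi 1 = 1,
    local_completely_contractive pn q W psi & forall x, W0 x -> psi x = phi x].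

Definition injective_operator_space (A : algType R[i]) (q : mxnorm A)
    (V : set A) : Prop :=
  forall (B : algType R[i]) (star : B -> B) (p : B -> R) (pn : mxnorm B),
    is_Cstar_algebra star p pn ->
  forall W0 W : set B, unital_subspace W0 -> unital_subspace W -> W0 `<=` W ->
  forall phi : B -> A, linear_between W0 V phi -> phi 1 = 1 ->
    completely_contractive pn q W0 phi ->
  exists psi : B -> A, [/\ linear_between W V psi, psi 1 = 1,
    completely_contractive pn q W psi & forall x, W0 x -> psi x = phi x].

(* closure for the topology of a directed family of seminorms *)
Definition seminorm_closure (I : Type) (A : algType R[i]) (p : I -> A -> R)
    (V : set A) : set A :=
  [set a | forall l (e : R), 0 < e -> exists2 b, V b & p l (a - b) < e].

(* b(V) = V `&` b(A) *)
Definition bounded_part (I A : Type) (p : I -> A -> R) (V : set A) : set A :=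
  [set a | V a /\ exists M : R, forall l, p l a <= M].

(* The norm of M_n(b(A)) = b(M_n(A)); only meaningful on bounded matrices. *)
Definition sup_mxnorm (I A : Type) (p : I -> mxnorm A) : mxnorm A :=
  fun n X => sup [set p l n X | l in setT].

End LocallyCstar.

(** * Quantized domains and C*(D_E) *)

(* The inner product is linear in its first argument. *)
Record hilbert_space (R : realType) := HilbertSpace {
  hs_space :> completeNormedModType R[i];
  hs_ip : hs_space -> hs_space -> R[i];
  hs_ipP : forall (c : R[i]) x y z,
    hs_ip (c *: x + y) z = c * hs_ip x z + hs_ip y z;
  hs_ipC : forall x y, hs_ip y x = ((hs_ip x y)^*)%C;
  hs_norm : forall x, hs_ip x x = `|x| ^+ 2 }.

(* qd_proj i is the orthogonal projection of H onto the closed subspace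
   H_i = qd_sub i. *)
Record quantized_domain (R : realType) (H : hilbert_space R)
    d (Omega : porderType d) := QuantizedDomain {
  qd_sub : Omega -> set H;
  qd_proj : Omega -> H -> H;
  qd_directed : directed Omega;
  qd_sub0 : forall i, qd_sub i 0;
  qd_subP : forall i (c : R[i]) x y,
    qd_sub i x -> qd_sub i y -> qd_sub i (c *: x + y);
  qd_closed : forall i, closed (qd_sub i);
  qd_nonzero : forall i, exists2 x, qd_sub i x & x != 0;
  qd_mono : forall i j, (i <= j)%O -> qd_sub i `<=` qd_sub j;
  qd_dense : dense (\bigcup_i qd_sub i);
  qd_projP : forall i x,
    qd_sub i (qd_proj i x) /\
    forall y, qd_sub i y -> hs_ip (x - qd_proj i x) y = 0 }.

Section QuantizedDomain.
Context {R : realType} {H : hilbert_space R}.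
Context {d : Order.disp_t} {Omega : porderType d}.
Variable Q : quantized_domain H Omega.

Definition commutative_domain : Prop :=
  forall i j x, qd_proj Q i (qd_proj Q j x) = qd_proj Q j (qd_proj Q i x).

(* the norm of the Hilbert space, with values in R rather than R[i] *)
Definition hnorm (x : H) : R := complex.Re `|x|.

(** The space D_E *)
Definition dom_pred : {pred H} := fun x => `[< (\bigcup_i qd_sub Q i) x >].

Lemma dom_submod_closed : submod_closed dom_pred.
Proof.
split.
  have [[i _] _] := qd_directed Q.
  by apply/asboolP; exists i => //; apply: qd_sub0.
move=> c x y /asboolP[i _ xi] /asboolP[j _ yj].
have [_ /(_ i j)[k [ik jk]]] := qd_directed Q.
by apply/asboolP; exists k => //; apply: qd_subP;
  [exact: (qd_mono ik) | exact: (qd_mono jk)].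
Qed.

HB.instance Definition _ :=
  GRing.isSubmodClosed.Build R[i] H dom_pred dom_submod_closed.

Record dom := Dom { dom_val :> H; _ : dom_val \in dom_pred }.

HB.instance Definition _ := [isSub for dom_val].
HB.instance Definition _ := [Choice of dom by <:].
HB.instance Definition _ := [SubChoice_isSubLmodule of dom by <:].

Lemma proj_in_dom i x : qd_proj Q i x \in dom_pred.
Proof. by apply/asboolP; exists i => //; case: (qd_projP Q i x). Qed.

(* P_i as a map H -> D_E *)
Definition dproj i (x : H) : dom := Dom (proj_in_dom i x).

(** The algebra C*(D_E) *)

(* P_i T is a restriction of T P_i: both are compared on D_E, the domain of
   P_i T; and T P_i = P_i T P_i is a bounded operator on H. *)
Definition in_cstarD (T : dom -> dom) : Prop :=
  linear T /\ forall i,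
  [/\ forall x : dom, dproj i (T x) = T (dproj i x),
      forall x : H, T (dproj i x) = dproj i (T (dproj i x)) &
      exists M : R, forall x : H, hnorm (T (dproj i x)) <= M * hnorm x].

Definition cstarD_pred : {pred (dom -> dom)} := fun T => `[< in_cstarD T >].

Lemma hnormD x y : hnorm (x + y) <= hnorm x + hnorm y.
Proof.
by rewrite /hnorm -raddfD; have := ler_normD x y; rewrite lecE => /andP[].
Qed.

Lemma hnormZ (c : R[i]) x : hnorm (c *: x) = complex.Re `|c| * hnorm x.
Proof.
rewrite /hnorm normrZ.
have /complex_realP[r ->] : `|x| \is Num.real by exact: normr_real.
by case: `|c| => u v /=; rewrite mulr0 subr0.
Qed.

Lemma hnorm_ge0 x : 0 <= hnorm x.
Proof. by have := normr_ge0 x; rewrite lecE => /andP[]. Qed.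

Lemma ip0l (y : H) : hs_ip 0 y = 0.
Proof.
have := hs_ipP 1 0 0 y; rewrite scale1r addr0 mul1r => /eqP.
by rewrite -subr_eq0 opprD addrA subrr sub0r oppr_eq0 => /eqP.
Qed.

Lemma proj_unique i x y : qd_sub Q i y ->
  (forall z, qd_sub Q i z -> hs_ip (x - y) z = 0) -> qd_proj Q i x = y.
Proof.
move=> yi xy; have [pi xp] := qd_projP Q i x.
set p := qd_proj Q i x in pi xp *.
have di : qd_sub Q i (p - y).
  by rewrite -scaleN1r addrC; apply: qd_subP.
have : hs_ip (p - y) (p - y) = 0.
  have e : p - y = (-1) *: (x - p) + (x - y).
    by rewrite scaleN1r opprB addrA subrK.
  by rewrite {1}e hs_ipP xp // xy // mulr0 addr0.
by rewrite hs_norm => /eqP; rewrite sqrf_eq0 normr_eq0 subr_eq0 => /eqP.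
Qed.

Lemma proj_id i x : qd_sub Q i x -> qd_proj Q i x = x.
Proof. by move=> xi; apply: proj_unique => // z zi; rewrite subrr ip0l. Qed.

Lemma proj_linear i (c : R[i]) x y :
  qd_proj Q i (c *: x + y) = c *: qd_proj Q i x + qd_proj Q i y.
Proof.
have [xi xp] := qd_projP Q i x; have [yi yp] := qd_projP Q i y.
apply: proj_unique => [|z zi]; first exact: qd_subP.
by rewrite opprD addrACA -scalerBr hs_ipP xp // yp // mulr0 addr0.
Qed.

Lemma hnorm_proj i x : hnorm (qd_proj Q i x) <= hnorm x.
Proof.
have [pi xp] := qd_projP Q i x; set p := qd_proj Q i x in pi xp *.
suff: `|p| <= `|x| by rewrite lecE => /andP[].
rewrite -(@ler_pXn2r _ 2) ?nnegrE ?normr_ge0 // -!hs_norm.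
have ipD (u v w : H) : hs_ip (u + v) w = hs_ip u w + hs_ip v w.
  by rewrite -[u]scale1r hs_ipP mul1r scale1r.
have ipDr (u v w : H) : hs_ip w (u + v) = hs_ip w u + hs_ip w v.
  by rewrite hs_ipC ipD rmorphD /= -!hs_ipC.
have pythagoras (u : H) : hs_ip u p = 0 ->
    hs_ip (u + p) (u + p) = hs_ip p p + hs_ip u u.
  by move=> up; rewrite ipD !ipDr up [hs_ip p u]hs_ipC up rmorph0 addr0 add0r addrC.
rewrite -[in leRHS](subrK p x) pythagoras; last exact: xp.
by rewrite lerDl hs_norm exprn_ge0.
Qed.

Lemma dproj_linear i (c : R[i]) (x y : H) :
  dproj i (c *: x + y) = c *: dproj i x + dproj i y.
Proof. by apply: val_inj; rewrite /= proj_linear. Qed.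

Lemma dproj_id i (x : H) : dproj i (dproj i x) = dproj i x.
Proof. by apply: val_inj; rewrite /= proj_id //; case: (qd_projP Q i x). Qed.

Lemma cstarD_submod_closed : submod_closed cstarD_pred.
Proof.
have val0 i : dproj i 0 = 0.
  by apply: val_inj; rewrite /= proj_id //; exact: qd_sub0.
split.
  apply/asboolP; split=> [c x y|i]; first by rewrite scaler0 addr0.
  split=> [x|x|]; rewrite ?val0 //.
  by exists 0 => x; rewrite mul0r /hnorm normr0.
move=> c S T /asboolP[Sl SP] /asboolP[Tl TP].
apply/asboolP; split=> [b x y|i].
  change (c *: S (b *: x + y) + T (b *: x + y) =
    b *: (c *: S x + T x) + (c *: S y + T y)).
  by rewrite Sl Tl !scalerDr !scalerA (mulrC c b) addrACA.
have [S1 S2 [MS S3]] := SP i; have [T1 T2 [MT T3]] := TP i.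
split=> [x|x|].
- change (dproj i (c *: S x + T x) = c *: S (dproj i x) + T (dproj i x)).
  by rewrite -S1 -T1 -dproj_linear.
- change (c *: S (dproj i x) + T (dproj i x) =
    dproj i (c *: S (dproj i x) + T (dproj i x))).
  by rewrite dproj_linear -S2 -T2.
- exists (complex.Re `|c| * MS + MT) => x.
  rewrite mulrDl -mulrA.
  have -> : dom_val ((c *: S + T) (dproj i x)) =
    c *: dom_val (S (dproj i x)) + dom_val (T (dproj i x)) by [].
  apply: le_trans (hnormD _ _) _.
  apply: lerD => //; rewrite hnormZ ler_wpM2l //.
  by have := normr_ge0 c; rewrite lecE => /andP[].
Qed.

HB.instance Definition _ :=
  GRing.isSubmodClosed.Build R[i] (dom -> dom) cstarD_pred cstarD_submod_closed.

Record cstarD :=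
  CstarD { cstarD_val :> dom -> dom; _ : cstarD_val \in cstarD_pred }.

HB.instance Definition _ := [isSub for cstarD_val].
HB.instance Definition _ := [Choice of cstarD by <:].
HB.instance Definition _ := [SubChoice_isSubLmodule of cstarD by <:].

Lemma cstarDP (T : cstarD) : in_cstarD T.
Proof. exact/asboolP/(valP T). Qed.

Lemma cstarD_ext (S T : cstarD) : (forall x, S x = T x) -> S = T.
Proof. by move=> ST; apply: val_inj; apply/funext. Qed.

Lemma cstarD_one_subproof : (fun x : dom => x) \in cstarD_pred.
Proof.
apply/asboolP; split=> // i; split=> // [x|]; first by rewrite dproj_id.
by exists 1 => x; rewrite mul1r hnorm_proj.
Qed.

Definition cstarD_one : cstarD := CstarD cstarD_one_subproof.

Lemma cstarD_mul_subproof (S T : cstarD) :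
  (fun x : dom => S (T x)) \in cstarD_pred.
Proof.
have [Sl SP] := cstarDP S; have [Tl TP] := cstarDP T.
apply/asboolP; split=> [c x y|i]; first by rewrite Tl Sl.
have [S1 S2 [MS S3]] := SP i; have [T1 T2 [MT T3]] := TP i.
split=> [x|x|]; first by rewrite S1 T1.
  by rewrite [in LHS]T2 [in LHS]S2 -T2.
exists (Num.max 0 MS * MT) => x; rewrite T2.
apply: le_trans (S3 _) _; rewrite -mulrA.
apply: (@le_trans _ _ (Num.max 0 MS * hnorm (T (dproj i x)))).
  by rewrite ler_wpM2r ?hnorm_ge0 // le_max lexx orbT.
by rewrite ler_wpM2l // le_max lexx.
Qed.

Definition cstarD_mul (S T : cstarD) : cstarD :=
  CstarD (cstarD_mul_subproof S T).

Lemma cstarD_linear (T : cstarD) : linear T.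
Proof. by case: (cstarDP T). Qed.

Lemma cstarD_addE (T : cstarD) x y : T (x + y) = T x + T y.
Proof. by rewrite -[x]scale1r cstarD_linear !scale1r. Qed.

Fact cstarD_mulA : associative cstarD_mul.
Proof. by move=> S T U; apply: cstarD_ext. Qed.
Fact cstarD_mul1l : left_id cstarD_one cstarD_mul.
Proof. by move=> T; apply: cstarD_ext. Qed.
Fact cstarD_mul1r : right_id cstarD_one cstarD_mul.
Proof. by move=> T; apply: cstarD_ext. Qed.
Fact cstarD_mulDl : left_distributive cstarD_mul +%R.
Proof. by move=> S T U; apply: cstarD_ext. Qed.
Fact cstarD_mulDr : right_distributive cstarD_mul +%R.
Proof. by move=> S T U; apply: cstarD_ext => x /=; rewrite cstarD_addE. Qed.
Fact cstarD_one_neq0 : cstarD_one != 0.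
Proof.
have [[i _] _] := qd_directed Q; have [x xi x0] := qd_nonzero Q i.
have xD : x \in dom_pred by apply/asboolP; exists i.
apply: contra x0 => /eqP/(congr1 (fun T : cstarD => dom_val (T (Dom xD)))) /= ->.
by [].
Qed.

HB.instance Definition _ := GRing.Zmodule_isNzRing.Build cstarD
  cstarD_mulA cstarD_mul1l cstarD_mul1r cstarD_mulDl cstarD_mulDr
  cstarD_one_neq0.

Fact cstarD_scaleAl (c : R[i]) (S T : cstarD) : c *: (S * T) = c *: S * T.
Proof. by apply: cstarD_ext. Qed.
HB.instance Definition _ :=
  GRing.Lmodule_isLalgebra.Build R[i] cstarD cstarD_scaleAl.

Fact cstarD_scaleAr (c : R[i]) (S T : cstarD) : c *: (S * T) = S * (c *: T).
Proof.
apply: cstarD_ext => x; change (c *: S (T x) = S (c *: T x)).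
have S0 : S 0 = 0.
  by apply: (addrI (S 0)); rewrite -cstarD_addE !addr0.
by rewrite -[c *: T x]addr0 cstarD_linear S0 addr0.
Qed.
HB.instance Definition _ :=
  GRing.Lalgebra_isAlgebra.Build R[i] cstarD cstarD_scaleAr.

(* the norm of T restricted to H_i *)
Definition cstarD_seminorm (i : Omega) (T : cstarD) : R :=
  sup [set hnorm (T x) | x in [set x : dom | qd_sub Q i x /\ hnorm x <= 1]].

(* Restriction to H_i embeds C*(D_E) / ker cstarD_seminorm i isometrically in
   B(H_i), so the norm of M_n(C*(D_E) / ker cstarD_seminorm i) is the norm of
   operators on the Hilbert space sum of n copies of H_i. *)
Definition cstarD_mxseminorm (i : Omega) : mxnorm cstarD := fun n X =>
  sup [set Num.sqrt (\sum_k hnorm (\sum_l X k l (x l) : dom) ^+ 2) |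
    x in [set x : 'I_n.+1 -> dom |
      (forall l, qd_sub Q i (x l)) /\ \sum_l hnorm (x l) ^+ 2 <= 1]].

Definition bounded_mxnorm : mxnorm cstarD := sup_mxnorm cstarD_mxseminorm.

Definition bpart (V : set cstarD) : set cstarD :=
  bounded_part cstarD_seminorm V.

(** * R-modules and injective R-envelopes *)

(* The subring of B(H) generated by the P_i and 1. *)
Inductive proj_ring : (H -> H) -> Prop :=
| proj_ring_one : proj_ring (fun x => x)
| proj_ring_proj i : proj_ring (qd_proj Q i)
| proj_ring_sub r s : proj_ring r -> proj_ring s ->
    proj_ring (fun x => r x - s x)
| proj_ring_mul r s : proj_ring r -> proj_ring s ->
    proj_ring (fun x => r (s x)).

(* S = r T *)
Definition is_lmul (r : H -> H) (T S : cstarD) : Prop :=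
  forall x : dom, dom_val (S x) = r (dom_val (T x)).

Definition R_module (W : set cstarD) : Prop :=
  unital_subspace W /\
  forall r T, proj_ring r -> W T -> exists2 S, W S & is_lmul r T S.

Definition R_map (W : set cstarD) (phi : cstarD -> cstarD) : Prop :=
  forall i T S, W T -> W S -> is_lmul (qd_proj Q i) T S ->
    is_lmul (qd_proj Q i) (phi T) (phi S).

Definition local_R_extension (V W : set cstarD) (i : cstarD -> cstarD) : Prop :=
  [/\ R_module W, linear_between V W i, i 1 = 1 &
      local_completely_isometric cstarD_mxseminorm cstarD_mxseminorm V i].

Definition local_R_rigid (V W : set cstarD) (i : cstarD -> cstarD) : Prop :=
  forall phi, linear_between W W phi -> phi 1 = 1 ->
    local_completely_contractive cstarD_mxseminorm cstarD_mxseminorm W phi ->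
    R_map W phi -> (forall T, V T -> phi (i T) = i T) ->
  forall T, W T -> phi T = T.

Definition local_injective_R_envelope (V W : set cstarD)
    (i : cstarD -> cstarD) : Prop :=
  [/\ local_R_extension V W i, local_R_rigid V W i &
      injective_local_operator_space cstarD_mxseminorm W].

Definition R_extension (U W : set cstarD) (i : cstarD -> cstarD) : Prop :=
  [/\ W `<=` bpart setT, R_module W, linear_between U W i, i 1 = 1 &
      completely_isometric bounded_mxnorm bounded_mxnorm U i].

Definition R_rigid (U W : set cstarD) (i : cstarD -> cstarD) : Prop :=
  forall phi, linear_between W W phi ->
    completely_contractive bounded_mxnorm bounded_mxnorm W phi ->
    R_map W phi -> (forall T, U T -> phi (i T) = i T) ->
  forall T, W T -> phi T = T.

Definition injective_R_envelope (U W : set cstarD)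
    (i : cstarD -> cstarD) : Prop :=
  [/\ R_extension U W i, R_rigid U W i &
      injective_operator_space bounded_mxnorm W].

Definition complete_isometric_R_map (W1 W2 : set cstarD)
    (phi : cstarD -> cstarD) : Prop :=
  [/\ linear_between W1 W2 phi, R_map W1 phi &
      completely_isometric bounded_mxnorm bounded_mxnorm W1 phi].

Definition unital_complete_order_R_isomorphism (W1 W2 : set cstarD)
    (phi : cstarD -> cstarD) : Prop :=
  phi 1 = 1 /\ complete_isometric_R_map W1 W2 phi /\
  exists psi, [/\ complete_isometric_R_map W2 W1 psi,
    forall T, W1 T -> psi (phi T) = T & forall T, W2 T -> phi (psi T) = T].

End QuantizedDomain.

Arguments cstarD_seminorm {R H d Omega} Q i T.
Arguments cstarD_mxseminorm {R H d Omega} Q i n X.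

(* Main.v *)
(** An R-map commutes with the P_i, so on the bounded part b(W) a completely
    contractive R-map is automatically contractive for every seminorm: cutting
    a matrix X over b(W) down by P_i bounds its sup norm by its i-th seminorm.
    As every T in W is the limit of the bounded elements P_i T, rigidity of b(W)
    follows by extending such a map to W, which is injective, and applying the
    rigidity of W; the extension fixes i(V) because b(V) is dense in V.
    Injectivity passes from W to b(W) because a map from a C*-algebra which is
    local completely contractive is contractive for the sup norm.  Hence b(W)
    itself is an injective R-envelope of b(V).  Using the injectivity of W on
    W itself requires that C*(D_E) is a locally C*-algebra. *)
Require Import Defs.
From mathcomp Require Import all_boot all_order all_algebra.
From mathcomp Require Import complex.
From mathcomp Require Import all_classical all_reals all_analysis.
From mathcomp Require Import ring lra.

Set Implicit Arguments.
Unset Strict Implicit.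
Unset Printing Implicit Defensive.

Import Order.TTheory GRing.Theory Num.Theory.
Import numFieldNormedType.Exports.
Local Open Scope classical_set_scope.
Local Open Scope complex_scope.
Local Open Scope ring_scope.

Lemma Re_norm_ge0 (R : realType) (c : R[i]) : 0 <= complex.Re `|c|.
Proof. by have := normr_ge0 c; rewrite lecE => /andP[]. Qed.

(** * Operator seminorms on a space with a real inner product *)

(* The real part of a complex inner product, written without reference to the
   complex one: [rip_conj] is what remains of sesquilinearity. *)
Record real_inner_product (R : realType) (E : lmodType R[i])
    (ip : E -> E -> R) : Prop := {
  ripD : forall x y z, ip (x + y) z = ip x z + ip y z;
  ripC : forall x y, ip x y = ip y x;
  rip_conj : forall (c : R[i]) x y, ip (c *: x) y = ip x ((c^*)%C *: y);
  rip_real : forall (r : R) x y, ip (r%:C *: x) y = r * ip x y;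
  rip_ge0 : forall x, 0 <= ip x x }.

Section RealInnerProduct.
Context {R : realType} {E : lmodType R[i]}.
Variable ip : E -> E -> R.
Hypothesis ipP : real_inner_product ip.

Definition ipnorm x := Num.sqrt (ip x x).

Let ipD := ripD ipP.
Let ipC := ripC ipP.
Let ipR := rip_real ipP.

Lemma ipDr x y z : ip x (y + z) = ip x y + ip x z.
Proof. by rewrite !(ipC x) ipD. Qed.

Lemma ipNl x y : ip (- x) y = - ip x y.
Proof.
have -> : - x = (-1)%:C *: x by rewrite rmorphN rmorph1 scaleN1r.
by rewrite ipR mulN1r.
Qed.

Lemma ipNr x y : ip x (- y) = - ip x y.
Proof. by rewrite ipC ipNl ipC. Qed.

Lemma ipRr r x y : ip x (r%:C *: y) = r * ip x y.
Proof. by rewrite ipC ipR ipC. Qed.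

Lemma ipnorm_ge0 x : 0 <= ipnorm x.
Proof. exact: sqrtr_ge0. Qed.

Lemma sqr_ipnorm x : ipnorm x ^+ 2 = ip x x.
Proof. by rewrite sqr_sqrtr // (rip_ge0 ipP). Qed.

(** Cauchy-Schwarz, from the nonnegativity of [ip (x - t y) (x - t y)] as a quadratic in the real
    variable [t]. The form is only semidefinite, so [ip y y = 0] is a case of its own. *)
Lemma ip_le_ipnorm x y : ip x y <= ipnorm x * ipnorm y.
Proof.
have [|xy0] := leP (ip x y) 0.
  by move/le_trans; apply; rewrite mulr_ge0 ?ipnorm_ge0.
rewrite -(@ler_pXn2r _ 2) ?nnegrE ?mulr_ge0 ?ipnorm_ge0 ?(ltW xy0) //.
rewrite exprMn !sqr_ipnorm.
have quad t : 0 <= ip x x - 2 * t * ip x y + t ^+ 2 * ip y y.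
  have := rip_ge0 ipP (x - t%:C *: y).
  rewrite ipD !ipDr !ipNl !ipNr !ipR !ipRr (ipC y x); congr (0 <= _); ring.
have := rip_ge0 ipP y; rewrite le_eqVlt => /orP[/eqP y0|y_gt0].
  (* The quadratic is now affine in [t] with negative slope, and at this [t] its value is -1. *)
  have := quad ((ip x x + 1) / (2 * ip x y)).
  rewrite -y0 !mulr0 addr0.
  have -> : 2 * ((ip x x + 1) / (2 * ip x y)) * ip x y = ip x x + 1.
    by field; apply: lt0r_neq0.
  by rewrite opprD addrA subrr sub0r oppr_ge0 ler10.
(* This is the minimiser of the quadratic. *)
have := quad (ip x y / ip y y).
have -> : ip x x - 2 * (ip x y / ip y y) * ip x y +
    (ip x y / ip y y) ^+ 2 * ip y y = (ip x x * ip y y - ip x y ^+ 2) / ip y y.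
  by field; apply: lt0r_neq0.
by rewrite pmulr_lge0 ?invr_gt0 // subr_ge0.
Qed.

Lemma ipnorm_le_sqr x (M : R) : 0 <= M -> ip x x <= M ^+ 2 -> ipnorm x <= M.
Proof.
by move=> M0 xM; rewrite -(@ler_pXn2r _ 2) ?nnegrE ?ipnorm_ge0 // sqr_ipnorm.
Qed.

Lemma ipnormD x y : ipnorm (x + y) <= ipnorm x + ipnorm y.
Proof.
apply: ipnorm_le_sqr; first by rewrite addr_ge0 ?ipnorm_ge0.
rewrite ipD !ipDr (ipC y x) sqrrD !sqr_ipnorm.
have := ip_le_ipnorm x y; lra.
Qed.

Lemma ipnormZ (c : R[i]) x : ipnorm (c *: x) = complex.Re `|c| * ipnorm x.
Proof.
have cge0 := Re_norm_ge0 c.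
rewrite /ipnorm (rip_conj ipP) scalerA.
have -> : (c^*)%C * c = (complex.Re `|c| ^+ 2)%:C.
  by rewrite mulrC -sqr_normc -[in LHS](RRe_real (normr_real c)) -rmorphXn.
by rewrite ipRr sqrtrM ?exprn_ge0 // sqrtr_sqr ger0_norm.
Qed.

Lemma ipnormZr (r : R) x : 0 <= r -> ipnorm (r%:C *: x) = r * ipnorm x.
Proof. by move=> r0; rewrite ipnormZ ger0_norm ?ler0c. Qed.

(** * Operator seminorms of maps restricted to a set [K], later [H_i] or a sum of copies of it *)

Section OperatorNorm.
Variable K : set E.
Hypothesis K_scale : forall (r : R) x, K x -> K (r%:C *: x).
Hypothesis K_unit : exists2 x, K x & ipnorm x != 0.

Definition opnorm (T : E -> E) : R :=
  sup [set ipnorm (T x) | x in [set x | K x /\ ipnorm x <= 1]].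

(** Real homogeneity is the part of linearity that rescaling a vector of [K] to the unit ball
    requires. *)
Record bounded_on (T : E -> E) : Prop := {
  bounded_on_stable : forall x, K x -> K (T x);
  bounded_on_scale : forall (r : R) x, T (r%:C *: x) = r%:C *: T x;
  bounded_on_bound : exists M, forall x, K x -> ipnorm (T x) <= M * ipnorm x }.

Let K0 : K 0.
Proof.
by have [x Kx _] := K_unit; rewrite -(scale0r x); exact: (K_scale 0).
Qed.

Lemma opnorm_ge (T : E -> E) x : bounded_on T -> K x ->
  ipnorm (T x) <= opnorm T * ipnorm x.
Proof.
move=> [TK Tr [M TM]] Kx.
have [x0|x0] := eqVneq (ipnorm x) 0.
  by apply: le_trans (TM _ Kx) _; rewrite x0 !mulr0.
have xgt0 : 0 < ipnorm x by rewrite lt_neqAle eq_sym x0 ipnorm_ge0.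
rewrite -ler_pdivrMr // mulrC -ipnormZr ?invr_ge0 ?ipnorm_ge0 // -Tr.
apply: ub_le_sup.
  (* The sign of [M] is not given, hence the maximum with 0. *)
  exists (Num.max 0 M) => _ [y [Ky y1] <-].
  apply: le_trans (TM _ Ky) _.
  apply: (@le_trans _ _ (Num.max 0 M * ipnorm y)).
    by rewrite ler_wpM2r ?ipnorm_ge0 // le_max lexx orbT.
  by rewrite ler_piMr // le_max lexx.
exists ((ipnorm x)^-1%:C *: x) => //; split; first exact: K_scale.
by rewrite ipnormZr ?invr_ge0 ?ipnorm_ge0 // mulVf.
Qed.

Lemma opnorm_le (T : E -> E) (M : R) : 0 <= M ->
  (forall x, K x -> ipnorm (T x) <= M * ipnorm x) -> opnorm T <= M.
Proof.
move=> M0 TM; apply: ge_sup.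
  by exists (ipnorm (T 0)); exists 0 => //; split; rewrite // /ipnorm
    -(scale0r (0 : E)) (ipR 0) mul0r sqrtr0.
by move=> _ [x [Kx x1] <-]; apply: le_trans (TM _ Kx) _; rewrite ler_piMr.
Qed.

Lemma opnorm_ge0 (T : E -> E) : bounded_on T -> 0 <= opnorm T.
Proof.
move=> Tb; have [x Kx x0] := K_unit.
have xgt0 : 0 < ipnorm x by rewrite lt_neqAle eq_sym x0 ipnorm_ge0.
rewrite -(pmulr_lge0 _ xgt0).
by apply: le_trans (opnorm_ge Tb Kx); exact: ipnorm_ge0.
Qed.

Lemma opnorm_triangle (S T U : E -> E) : bounded_on S -> bounded_on T ->
  (forall x, U x = S x + T x) -> opnorm U <= opnorm S + opnorm T.
Proof.
move=> Sb Tb UE; apply: opnorm_le; first by rewrite addr_ge0 ?opnorm_ge0.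
move=> x Kx; rewrite UE mulrDl; apply: le_trans (ipnormD _ _) _.
by apply: lerD; exact: opnorm_ge.
Qed.

Lemma opnorm_mul (S T U : E -> E) : bounded_on S -> bounded_on T ->
  (forall x, U x = S (T x)) -> opnorm U <= opnorm S * opnorm T.
Proof.
move=> Sb Tb UE; apply: opnorm_le; first by rewrite mulr_ge0 ?opnorm_ge0.
move=> x Kx; rewrite UE.
apply: le_trans (opnorm_ge Sb (bounded_on_stable Tb Kx)) _.
by rewrite -mulrA ler_wpM2l ?opnorm_ge0 // opnorm_ge.
Qed.

Lemma opnorm_scale (c : R[i]) (T U : E -> E) : bounded_on T -> bounded_on U ->
  (forall x, U x = c *: T x) -> opnorm U = complex.Re `|c| * opnorm T.
Proof.
move=> Tb Ub UE.
have cge0 := Re_norm_ge0 c.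
apply/eqP; rewrite eq_le; apply/andP; split.
  apply: opnorm_le => [|x Kx]; first by rewrite mulr_ge0 // opnorm_ge0.
  by rewrite UE ipnormZ -mulrA ler_wpM2l // opnorm_ge.
have [->|c0] := eqVneq (complex.Re `|c|) 0; first by rewrite mul0r opnorm_ge0.
have cgt0 : 0 < complex.Re `|c| by rewrite lt_neqAle eq_sym c0.
rewrite mulrC -ler_pdivlMr //; apply: opnorm_le.
  by rewrite divr_ge0 // opnorm_ge0.
move=> x Kx; rewrite mulrAC ler_pdivlMr // mulrC -ipnormZ -UE.
exact: opnorm_ge.
Qed.

Lemma opnorm_id : opnorm id = 1.
Proof.
have idb : bounded_on id by split=> //; exists 1 => x _; rewrite mul1r.
apply/eqP; rewrite eq_le; apply/andP; split.
  by apply: opnorm_le => // x _; rewrite mul1r.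
have [x Kx x0] := K_unit.
have xgt0 : 0 < ipnorm x by rewrite lt_neqAle eq_sym x0 ipnorm_ge0.
by rewrite -(ler_pM2r xgt0) mul1r (opnorm_ge idb).
Qed.

(** Cauchy-Schwarz applied to [ip (S x) (S x) = ip (T (S x)) x] bounds the square of the norm of
    [S x] by [opnorm T] times the norms of [S x] and [x]; one factor then cancels. *)
Lemma opnorm_adj_le (S T : E -> E) : bounded_on S -> bounded_on T ->
  (forall x y, K x -> K y -> ip (T x) y = ip x (S y)) -> opnorm S <= opnorm T.
Proof.
move=> Sb Tb adjST; apply: opnorm_le => [|x Kx]; first exact: opnorm_ge0.
have KS := bounded_on_stable Sb Kx.
have : ipnorm (S x) ^+ 2 <= opnorm T * ipnorm (S x) * ipnorm x.
  rewrite sqr_ipnorm -adjST //; apply: le_trans (ip_le_ipnorm _ _) _.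
  by rewrite ler_wpM2r ?ipnorm_ge0 // opnorm_ge.
have [->|S0] := eqVneq (ipnorm (S x)) 0.
  by rewrite mulr_ge0 ?opnorm_ge0 ?ipnorm_ge0.
have Sgt0 : 0 < ipnorm (S x) by rewrite lt_neqAle eq_sym S0 ipnorm_ge0.
by rewrite expr2 mulrAC ler_pM2r.
Qed.

Lemma opnorm_adj (S T : E -> E) : bounded_on S -> bounded_on T ->
  (forall x y, K x -> K y -> ip (T x) y = ip x (S y)) -> opnorm S = opnorm T.
Proof.
move=> Sb Tb adj; apply/eqP; rewrite eq_le !opnorm_adj_le // => x y Kx Ky.
by rewrite ipC -adj // ipC.
Qed.

(** One inequality is submultiplicativity together with [opnorm_adj_le]. The other is Cauchy-Schwarz
    applied to [ip (T x) (T x) = ip x (U x)], read as a bound of [opnorm T] by the square root of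
    [opnorm U]. *)
Lemma opnorm_Cstar (S T U : E -> E) : bounded_on S -> bounded_on T ->
  (forall x y, K x -> K y -> ip (T x) y = ip x (S y)) ->
  (forall x, U x = S (T x)) -> opnorm U = opnorm T ^+ 2.
Proof.
move=> Sb Tb adjST UE.
have Ub : bounded_on U.
  split=> [x Kx|r x|].
  - by rewrite UE; do 2!apply: bounded_on_stable => //.
  - by rewrite !UE (bounded_on_scale Tb) (bounded_on_scale Sb).
  exists (opnorm S * opnorm T) => x Kx; rewrite UE.
  apply: le_trans (opnorm_ge Sb (bounded_on_stable Tb Kx)) _.
  by rewrite -mulrA ler_wpM2l ?opnorm_ge0 // opnorm_ge.
apply/eqP; rewrite eq_le; apply/andP; split.
  apply: le_trans (opnorm_mul Sb Tb UE) _.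
  by rewrite expr2 ler_wpM2r ?opnorm_ge0 // opnorm_adj_le.
rewrite -[leRHS]sqr_sqrtr ?opnorm_ge0 //.
rewrite ler_pXn2r ?nnegrE ?sqrtr_ge0 ?opnorm_ge0 //.
apply: opnorm_le => [|x Kx]; first exact: sqrtr_ge0.
apply: ipnorm_le_sqr; first by rewrite mulr_ge0 ?sqrtr_ge0 ?ipnorm_ge0.
rewrite adjST //; last exact: (bounded_on_stable Tb).
rewrite -UE exprMn sqr_sqrtr ?opnorm_ge0 //.
apply: le_trans (ip_le_ipnorm _ _) _; rewrite mulrC expr2 mulrA.
by rewrite ler_wpM2r ?ipnorm_ge0 // opnorm_ge.
Qed.

End OperatorNorm.
End RealInnerProduct.

(** * The Riesz representation theorem *)

Section Hilbert.
Context {R : realType} {H : hilbert_space R}.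
Implicit Types x y z : H.

Definition rip x y : R := complex.Re (hs_ip x y).

Lemma rip_inner_product : real_inner_product rip.
Proof.
have ipZ (c : R[i]) x y : hs_ip (c *: x) y = c * hs_ip x y.
  by have := hs_ipP c x 0 y; rewrite ip0l !addr0.
split=> [x y z|x y|c x y|r x y|x]; rewrite /rip.
- by have := hs_ipP 1 x y z; rewrite scale1r mul1r => ->; rewrite raddfD.
- by rewrite [in LHS]hs_ipC; case: (hs_ip y x).
- by rewrite ipZ [hs_ip x (_ *: y)]hs_ipC ipZ rmorphM /= conjcK -hs_ipC.
- by rewrite ipZ; case: (hs_ip x y) => a b /=; rewrite mul0r subr0.
- have := exprn_ge0 2 (normr_ge0 x).
  by rewrite hs_norm lecE => /andP[].
Qed.

Lemma hnormE x : (hnorm x)%:C = `|x|.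
Proof. exact/RRe_real/normr_real. Qed.

Lemma hnorm_ipnorm x : hnorm x = ipnorm rip x.
Proof.
rewrite /ipnorm /rip hs_norm -hnormE -rmorphXn sqrtr_sqr ger0_norm //.
exact: hnorm_ge0.
Qed.

Lemma sqr_hnorm x : hnorm x ^+ 2 = rip x x.
Proof. by rewrite hnorm_ipnorm (sqr_ipnorm rip_inner_product). Qed.

Lemma hnorm0_eq0 x : hnorm x = 0 -> x = 0.
Proof. by move=> x0; apply/eqP; rewrite -normr_eq0 -hnormE x0. Qed.

Lemma hnormN x : hnorm (- x) = hnorm x.
Proof. by rewrite /hnorm normrN. Qed.

Lemma hnorm0 : hnorm (0 : H) = 0.
Proof. by rewrite /hnorm normr0. Qed.

Lemma rip_le x y : rip x y <= hnorm x * hnorm y.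
Proof. by rewrite !hnorm_ipnorm; exact: (ip_le_ipnorm rip_inner_product). Qed.

Lemma ball_hnorm x (e : R) y : ball x e%:C y <-> hnorm (y - x) < e.
Proof. by rewrite -ball_normE /= distrC -hnormE ltcR. Qed.

(** * Limits in the Hilbert space along filters, with real radii *)

Section HnormLimit.
Context {T : Type} (F : set_system T) {FF : ProperFilter F}.
Implicit Types (u v : T -> H) (a b : H).

Definition hnorm_cvg u a :=
  forall e : R, 0 < e -> F [set t | hnorm (u t - a) < e].

Lemma hnorm_cvg_le u a b (M : R) : hnorm_cvg u a ->
  F [set t | hnorm (u t - b) <= M] -> hnorm (a - b) <= M.
Proof.
move=> ua ub; apply/ler_addgt0Pr => e e0.
have [t [/= tb ta]] := filter_ex (filterI ub (ua _ e0)).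
have -> : a - b = (u t - b) - (u t - a) by rewrite opprB [RHS]addrC addrA subrK.
apply: le_trans (Defs.hnormD _ _) _; rewrite hnormN.
by apply: lerD => //; exact: ltW.
Qed.

Lemma hnorm_cvg_unique u a b : hnorm_cvg u a -> hnorm_cvg u b -> a = b.
Proof.
move=> ua ub; apply/eqP; rewrite -subr_eq0; apply/eqP/hnorm0_eq0.
apply/eqP; rewrite eq_le hnorm_ge0 andbT; apply/ler_addgt0Pr => e e0.
rewrite add0r; apply: (hnorm_cvg_le ua).
by apply: filterS (ub _ e0) => t /ltW.
Qed.

Lemma hnorm_cvg_linear (c : R[i]) u v a b : hnorm_cvg u a -> hnorm_cvg v b ->
  hnorm_cvg (fun t => c *: u t + v t) (c *: a + b).
Proof.
move=> ua vb e e0.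
have c0 := Re_norm_ge0 c.
have c1 : 0 < complex.Re `|c| + 1 by rewrite ltr_wpDl.
have ce0 : 0 < e / (2 * (complex.Re `|c| + 1)) by rewrite divr_gt0 // mulr_gt0.
have e20 : 0 < e / 2 by rewrite divr_gt0.
apply: filterS (filterI (ua _ ce0) (vb _ e20)) => t [ta tb].
have {}ta : hnorm (u t - a) < e / (2 * (complex.Re `|c| + 1)) by [].
have {}tb : hnorm (v t - b) < e / 2 by [].
change (hnorm (c *: u t + v t - (c *: a + b)) < e).
rewrite opprD addrACA -scalerBr; apply: le_lt_trans (Defs.hnormD _ _) _.
rewrite Defs.hnormZ.
move: c0 ta tb (hnorm_ge0 (u t - a)); rewrite ltr_pdivlMr ?mulr_gt0 //.
move: (hnorm (u t - a)) (hnorm (v t - b)) (complex.Re _) => r s q; nra.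
Qed.

End HnormLimit.

Lemma hilbert_complete (T : Type) (F : set_system T) (u : T -> H) :
  ProperFilter F ->
  (forall e : R, 0 < e -> exists x, F [set t | hnorm (u t - x) < e]) ->
  exists l, hnorm_cvg F u l.
Proof.
move=> FF Fc.
have : cauchy (u @ F).
  apply: cauchy_exP => e e0.
  (* The radii of the topology of [H] live in [R[i]], where a positive element is real. *)
  have eE : e = (complex.Re e)%:C by rewrite RRe_real // gtr0_real.
  have [|x Fx] := Fc (complex.Re e); first by move: e0; rewrite ltcE => /andP[].
  exists x; rewrite eE; change (F [set t | ball x (complex.Re e)%:C (u t)]).
  by apply: filterS Fx => t tx; apply/ball_hnorm.
move/cauchy_cvg => /cvg_ex[l ul]; exists l => e e0.
have /(cvg_ball ul) : 0 < e%:C by rewrite ltcR.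
by apply: filterS => t /ball_hnorm.
Qed.

Lemma hilbert_closed (T : Type) (F : set_system T) (u : T -> H) (A : set H) l :
  ProperFilter F -> closed A -> F [set t | A (u t)] ->
  hnorm_cvg F u l -> A l.
Proof.
move=> FF Acl FA ul; apply: (closed_cvg A Acl FA).
apply/cvg_ballP => e e0.
have eE : e = (complex.Re e)%:C by rewrite RRe_real // gtr0_real.
rewrite eE; have /ul : 0 < complex.Re e by move: e0; rewrite ltcE => /andP[].
by apply: filterS => t /ball_hnorm.
Qed.

(** The representing vector minimises [J z = rip z z - 2 f z]: minimising filters are Cauchy by the
    parallelogram law, and the vanishing of the first variation of [J] at the limit is the identity
    [f = rip _ y]. *)
Lemma riesz (f : H -> R) (M : R) :
  (forall x y, f (x + y) = f x + f y) ->
  (forall (r : R) x, f (r%:C *: x) = r * f x) ->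
  (forall x, f x <= M * hnorm x) ->
  exists y, forall x, f x = rip x y.
Proof.
move=> fD fR fM.
have ipP := rip_inner_product.
pose J z := rip z z - 2 * f z.
have JD z w : J (z + w) = J z + rip w w + 2 * (rip w z - f w).
  rewrite /J fD (ripD ipP) !(ipDr ipP) (ripC ipP z w); ring.
have Jinf : has_inf (range J).
  split; first by exists (J 0); exists 0.
  (* Completing the square: [J z] is at least [(hnorm z - M)^2 - M^2]. *)
  exists (- M ^+ 2) => _ [z _ <-]; rewrite /J -sqr_hnorm.
  have := fM z; have := sqr_ge0 (hnorm z - M); rewrite sqrrB; lra.
set m := inf (range J).
have Jm z : m <= J z by apply: ge_inf; [case: Jinf | exists z].
have Jnear (e : R) : 0 < e -> exists z, J z < m + e.
  by move=> e0; have [_ [z _ <-] ze] := inf_adherent e0 Jinf; exists z.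
pose F := filter_from [set e : R | 0 < e] (fun e => [set z | J z < m + e]).
have FF : ProperFilter F.
  apply: filter_from_proper => [|e e0]; last exact: Jnear.
  apply: filter_from_filter => [|a b a0 b0]; first by exists 1; exact: ltr01.
  exists (Num.min a b); first by rewrite /= lt_min; apply/andP.
  move=> z /= zab; split; apply: lt_le_trans zab _;
    by rewrite lerD2l ge_min lexx ?orbT.
have [e e0|y ylim] := @hilbert_complete _ F id FF.
  (* The value of [J] at the midpoint of [z] and [z0] is the mean of [J z] and [J z0] minus a
     quarter of the squared distance, and it is at least [m]. So if both values are below
     [m + e^2 / 4], the distance is below [e]. *)
  have e4 : 0 < e ^+ 2 / 4 by rewrite divr_gt0 ?exprn_gt0.
  have [z0 z0e] := Jnear _ e4; exists z0, (e ^+ 2 / 4) => // z /= ze.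
  rewrite -(@ltr_pXn2r _ 2) ?nnegrE ?hnorm_ge0 ?(ltW e0) // sqr_hnorm.
  have := Jm ((2^-1)%:C *: (z - z0) + z0).
  rewrite addrC JD fR (rip_real ipP _ _ (_ *: _)) (ripC ipP (z - z0)).
  rewrite (rip_real ipP) (rip_real ipP).
  move: ze; have -> : J z = J (z0 + (z - z0)) by rewrite addrC subrK.
  rewrite JD; lra.
exists y.
have Jy : J y <= m.
  have [/lt_le_trans/(_ (lexx _))|//] := ltP m (J y) => mJy.
  have C0 : 0 <= hnorm y + `|M| by rewrite addr_ge0 ?hnorm_ge0.
  have e0 : 0 < J y - m by rewrite subr_gt0.
  (* Lower semicontinuity of [J] at [y]: with [w = z - y], [J z] is at least
     [J y - 2 (hnorm y + |M|) hnorm w]. This radius keeps the loss below [(J y - m) / 2], which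
     contradicts the choice of [z]. *)
  have d0 : 0 < (J y - m) / (4 * (hnorm y + `|M| + 1)).
    by rewrite divr_gt0 // mulr_gt0 // ltr_wpDl.
  have Fm : F [set z | J z < m + (J y - m) / 2].
    by exists ((J y - m) / 2) => //=; rewrite divr_gt0.
  have [z [/= zm zy]] := filter_ex (filterI Fm (ylim _ d0)).
  have JE : J z = J (y + (z - y)) by rewrite addrC subrK.
  move: zm zy; rewrite JE JD; set w := z - y => zm.
  rewrite ltr_pdivlMr; last by rewrite mulr_gt0 // ltr_wpDl.
  have := rip_le (- w) y; rewrite (ipNl ipP) hnormN.
  have := fM w.
  have : M * hnorm w <= `|M| * hnorm w.
    by rewrite ler_wpM2r ?hnorm_ge0 ?ler_norm.
  have := rip_ge0 ipP w; have := hnorm_ge0 w; move: zm; nra.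
move=> w; apply/esym/eqP; rewrite -subr_eq0; apply/eqP.
set b := rip w y - f w; set a := rip w w.
have a0 : 0 <= a by exact: (rip_ge0 ipP).
have quad t : 0 <= t ^+ 2 * a + 2 * t * b.
  have := le_trans Jy (Jm (y + t%:C *: w)).
  rewrite JD !(rip_real ipP) (ipRr ipP) fR -addrA lerDl.
  by congr (0 <= _); rewrite /a /b; ring.
(* The 1 keeps the denominator positive when [a = 0]; the value found is a negative multiple of
   [b^2], so [b = 0]. *)
have := quad (- b / (a + 1)).
have a1 : 0 < a + 1 by rewrite ltr_wpDl.
have -> : (- b / (a + 1)) ^+ 2 * a + 2 * (- b / (a + 1)) * b =
    - (b ^+ 2 * ((a + 2) / (a + 1) ^+ 2)) by field; exact: lt0r_neq0.
rewrite oppr_ge0 pmulr_lle0; last by rewrite divr_gt0 ?exprn_gt0 // ltr_wpDl.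
by move=> b2; apply/eqP; rewrite -sqrf_eq0 eq_le b2 sqr_ge0.
Qed.

End Hilbert.

(** * The locally C*-algebra of a quantized domain *)

Section CstarD.
Context {R : realType} {H : hilbert_space R}.
Context {d : Order.disp_t} {Omega : porderType d}.
Variable Q : quantized_domain H Omega.
Local Notation dom := (dom Q).
Local Notation cstarD := (cstarD Q).

Definition dip (x y : dom) : R := rip (x : H) y.

Lemma dip_inner_product : real_inner_product dip.
Proof.
have ipP := @rip_inner_product R H.
split=> [x y z|x y|c x y|r x y|x]; rewrite /dip.
- exact: (ripD ipP).
- exact: (ripC ipP).
- exact: (rip_conj ipP).
- exact: (rip_real ipP).
- exact: (rip_ge0 ipP).
Qed.

Lemma ipnorm_dip (x : dom) : ipnorm dip x = hnorm x.
Proof. by rewrite hnorm_ipnorm. Qed.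

Lemma dip_inj (a b : dom) : (forall x, dip x a = dip x b) -> a = b.
Proof.
move=> ab; apply/eqP; rewrite -subr_eq0; apply/eqP/val_inj/hnorm0_eq0.
apply/eqP; rewrite -sqrf_eq0 sqr_hnorm; apply/eqP.
change (dip (a - b) (a - b) = 0).
by rewrite (ipDr dip_inner_product) (ipNr dip_inner_product) ab subrr.
Qed.

Lemma rip_proj i (x y : H) : rip (qd_proj Q i x) y = rip x (qd_proj Q i y).
Proof.
have half (u v : H) :
      rip u (qd_proj Q i v) = rip (qd_proj Q i u) (qd_proj Q i v).
  have [_ up] := qd_projP Q i u; have [vi _] := qd_projP Q i v.
  have := ripD (@rip_inner_product R H) (u - qd_proj Q i u) (qd_proj Q i u)
    (qd_proj Q i v).
  by rewrite subrK {2}/rip up //= add0r.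
by rewrite [RHS]half (ripC rip_inner_product) half (ripC rip_inner_product).
Qed.

Definition subdom i : set dom := [set x | qd_sub Q i x].

Lemma dproj_sub i (x : dom) : subdom i x -> dproj Q i x = x.
Proof. by move=> xi; apply/val_inj/proj_id. Qed.

Lemma subdom_dproj i (x : H) : subdom i (dproj Q i x).
Proof. by have [] := qd_projP Q i x. Qed.

Lemma subdom_ex (x : dom) : exists i, subdom i x.
Proof. by have /asboolP[i _ xi] := valP x; exists i. Qed.

Lemma subdomP i (c : R[i]) (x y : dom) :
  subdom i x -> subdom i y -> subdom i (c *: x + y).
Proof. exact: qd_subP. Qed.

Lemma subdomZ i (c : R[i]) (x : dom) : subdom i x -> subdom i (c *: x).
Proof.
by move=> xi; rewrite -[_ *: _]addr0; apply: subdomP => //; exact: qd_sub0.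
Qed.

Lemma subdomD i (x y : dom) : subdom i x -> subdom i y -> subdom i (x + y).
Proof. by move=> xi yi; rewrite -[x]scale1r; apply: subdomP. Qed.

Lemma subdom_sum i n (x : 'I_n -> dom) :
  (forall k, subdom i (x k)) -> subdom i (\sum_k x k).
Proof.
by move=> xi; elim/big_ind: _ => //; [exact: qd_sub0 | exact: subdomD].
Qed.

Lemma subdom_unit i : exists2 x, subdom i x & ipnorm dip x != 0.
Proof.
have [x xi x0] := qd_nonzero Q i; exists (dproj Q i x).
  exact: subdom_dproj.
rewrite ipnorm_dip /= proj_id //; apply: contra x0 => /eqP/hnorm0_eq0 ->.
by [].
Qed.

Lemma cstarD_dproj (T : cstarD) i (x : dom) : dproj Q i (T x) = T (dproj Q i x).
Proof. by have [_ /(_ i)[]] := cstarDP T. Qed.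

Lemma cstarD_subdom (T : cstarD) i x : subdom i x -> subdom i (T x).
Proof.
by move=> /dproj_sub <-; rewrite -cstarD_dproj; exact: subdom_dproj.
Qed.

Lemma cstarD_0E (T : cstarD) : T 0 = 0.
Proof. by apply: (addrI (T 0)); rewrite -cstarD_addE !addr0. Qed.

Lemma cstarD_scaleE (T : cstarD) (c : R[i]) x : T (c *: x) = c *: T x.
Proof. by rewrite -[c *: x]addr0 cstarD_linear cstarD_0E addr0. Qed.

Lemma cstarD_sumE n (T : 'I_n -> cstarD) x : (\sum_k T k) x = \sum_k T k x.
Proof.
have : (\sum_k T k : cstarD) x = \sum_k T k x.
  by elim/big_ind2: _ => // S a U b <- <-.
by [].
Qed.

Lemma cstarD_bounded (T : cstarD) i : bounded_on dip (subdom i) T.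
Proof.
split=> [x|r x|]; [exact: cstarD_subdom | exact: cstarD_scaleE |].
have [_ /(_ i)[_ _ [M TM]]] := cstarDP T.
by exists M => x xi; rewrite !ipnorm_dip -{1}(dproj_sub xi).
Qed.

Lemma cstarD_seminormE i (T : cstarD) :
  cstarD_seminorm Q i T = opnorm dip (subdom i) T.
Proof.
rewrite /cstarD_seminorm /opnorm; congr sup.
by apply/seteqP; split=> _ [x [xi x1] <-]; exists x; rewrite ?ipnorm_dip //;
  split; rewrite // ?ipnorm_dip // -ipnorm_dip.
Qed.

(** For [y] in [H_i] the functional sending [x] to the real product of [T (P_i x)] with [y] is
    bounded on all of [H], so Riesz represents it by some [z], and [P_i z] lies in the domain.
    Self-adjointness of [P_i] and its commutation with [T] remove the cut-off from [x]. Every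
    property of the resulting [S] is then tested against all vectors with [dip_inj]. *)
Lemma exists_adjoint (T : cstarD) :
  exists S : cstarD, forall x y, dip (T x) y = dip x (S y).
Proof.
have ipP := dip_inner_product.
have /choice[S TS] : forall y : dom, exists z, forall x, dip (T x) y = dip x z.
  move=> y; have [i yi] := subdom_ex y.
  have [_ /(_ i)[_ _ [M TM]]] := cstarDP T.
  have [||x|z zP] :=
    @riesz R H (fun x => dip (T (dproj Q i x)) y) (M * hnorm y).
  - move=> x x'; rewrite -[in LHS](scale1r x) dproj_linear scale1r cstarD_addE.
    exact: (ripD ipP).
  - move=> r x; rewrite -[r%:C *: x]addr0 dproj_linear.
    have -> : dproj Q i 0 = 0.
      by apply: val_inj; rewrite /= proj_id //; exact: qd_sub0.
    by rewrite addr0 cstarD_scaleE (rip_real ipP).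
  - apply: le_trans (rip_le _ _) _.
    by rewrite mulrAC ler_wpM2r ?hnorm_ge0.
  exists (dproj Q i z) => x.
  rewrite -(dproj_sub yi) /dip -rip_proj.
  have -> : qd_proj Q i (T x) = T (dproj Q i x).
    by rewrite -cstarD_dproj.
  by rewrite -rip_proj -(dproj_id Q i x); exact: zP.
have Slin : linear S.
  move=> c y y'; apply: dip_inj => x.
  rewrite -TS !(ipDr ipP) -TS -[X in dip x (c *: X)]scale1r.
  (* [rip_conj] moves a scalar across the real form only with a conjugation, so [c] is written as a
     double conjugate. *)
  have cc : c = ((c^*)^*)%C by rewrite conjcK.
  rewrite scale1r [in LHS]cc [in RHS]cc -!(rip_conj ipP) -TS.
  by rewrite cstarD_scaleE.
have SP i (x : dom) : dproj Q i (S x) = S (dproj Q i x).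
  apply: dip_inj => y.
  rewrite -TS.
  have -> : dip (T y) (dproj Q i x) = dip (T (dproj Q i y)) x.
    by rewrite -cstarD_dproj /dip rip_proj.
  by rewrite TS /dip rip_proj.
have SD : S \in @cstarD_pred _ _ _ _ Q.
  apply/asboolP; split=> // i; split=> [x|x|]; first exact: SP.
    by rewrite SP dproj_id.
  have [_ _ [M TM]] := cstarD_bounded T i.
  exists (Num.max 0 M) => x; set y := dproj Q i x.
  have M0 : 0 <= Num.max 0 M by rewrite le_max lexx.
  have yi : subdom i y by exact: subdom_dproj.
  have Syi : subdom i (S y) by rewrite -(dproj_sub yi) -SP; exact: subdom_dproj.
  apply: (@le_trans _ _ (Num.max 0 M * hnorm y)); last first.
    by rewrite ler_wpM2l // hnorm_proj.
  have [->|Sy0] := eqVneq (hnorm (S y)) 0; first by rewrite mulr_ge0 ?hnorm_ge0.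
  have Sgt0 : 0 < hnorm (S y) by rewrite lt_neqAle eq_sym Sy0 hnorm_ge0.
  (* The squared norm of [S y] is the product of [T (S y)] with [y]; the bound [M] for [T] on [H_i]
     applies because [S y] is in [H_i]. *)
  rewrite -(ler_pM2r Sgt0) -expr2 sqr_hnorm.
  have -> : rip (S y : H) (S y) = dip (T (S y)) y by rewrite TS.
  apply: le_trans (rip_le _ _) _; rewrite mulrAC ler_wpM2r ?hnorm_ge0 //.
  have := TM _ Syi; rewrite !ipnorm_dip => /le_trans; apply.
  by rewrite ler_wpM2r ?hnorm_ge0 // le_max lexx orbT.
by exists (CstarD SD).
Qed.

(** The choice is harmless, as [dip_inj] makes the adjoint unique. *)
Definition cstarD_adj (T : cstarD) : cstarD := projT1 (cid (exists_adjoint T)).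

Lemma cstarD_adjP (T : cstarD) x y : dip (T x) y = dip x (cstarD_adj T y).
Proof. by rewrite /cstarD_adj; case: cid. Qed.

Lemma cstarD_adj_involution : is_involution cstarD_adj.
Proof.
have ipP := dip_inner_product.
split=> [T|S T|c T|S T]; apply: cstarD_ext => y; apply: dip_inj => x.
- by rewrite -cstarD_adjP (ripC ipP) -cstarD_adjP (ripC ipP).
- rewrite -cstarD_adjP.
  change (dip (S x + T x) y = dip x (cstarD_adj S y + cstarD_adj T y)).
  by rewrite (ripD ipP) (ipDr ipP) !cstarD_adjP.
- rewrite -cstarD_adjP.
  change (dip (c *: T x) y = dip x ((c^*)%C *: cstarD_adj T y)).
  by rewrite -(rip_conj ipP) -cstarD_scaleE cstarD_adjP (rip_conj ipP).
- rewrite -cstarD_adjP.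
  change (dip (S (T x)) y = dip x (cstarD_adj T (cstarD_adj S y))).
  by rewrite !cstarD_adjP.
Qed.

Lemma subdom_scale i (r : R) (x : dom) : subdom i x -> subdom i (r%:C *: x).
Proof. exact: subdomZ. Qed.

Lemma cstarD_seminorm_ge i (T : cstarD) x : subdom i x ->
  hnorm (T x) <= cstarD_seminorm Q i T * hnorm x.
Proof.
rewrite cstarD_seminormE -!ipnorm_dip; apply: opnorm_ge.
- exact: dip_inner_product.
- exact: subdom_scale.
- exact: cstarD_bounded.
Qed.

Lemma cstarD_seminorm_le i (T : cstarD) (M : R) : 0 <= M ->
  (forall x : dom, subdom i x -> hnorm (T x) <= M * hnorm x) ->
  cstarD_seminorm Q i T <= M.
Proof.
move=> M0 TM; rewrite cstarD_seminormE; apply: opnorm_le => //.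
- exact: dip_inner_product.
- exact: subdom_scale.
- exact: subdom_unit.
- by move=> x xi; rewrite !ipnorm_dip; exact: TM.
Qed.

Lemma cstarD_seminorm_ge0 i (T : cstarD) : 0 <= cstarD_seminorm Q i T.
Proof.
rewrite cstarD_seminormE; apply: opnorm_ge0.
- exact: dip_inner_product.
- exact: subdom_scale.
- exact: subdom_unit.
- exact: cstarD_bounded.
Qed.

Lemma hnorm_sum m (x : 'I_m -> dom) :
  hnorm (\sum_k x k : dom) <= \sum_k hnorm (x k).
Proof.
apply: (big_ind2 (fun (a : dom) r => hnorm a <= r)) => // [|a r b s ar bs].
  by rewrite hnorm0.
by apply: le_trans (Defs.hnormD _ _) _; exact: lerD.
Qed.

(** * Matrices over C*(D_E) acting on tuples of domain vectors *)

Section MatrixNorm.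
Variable n : nat.
Local Notation domn := ('I_n.+1 -> dom).
Implicit Types (X Y : 'M[cstarD]_n.+1) (x y : domn).

Definition mxdip x y : R := \sum_k dip (x k) (y k).

Definition mxact X x : domn := fun k => \sum_l X k l (x l).

Definition mxsubdom i : set domn := [set x | forall l, subdom i (x l)].

Lemma mxdip_inner_product : real_inner_product mxdip.
Proof.
have ipP := dip_inner_product.
split=> [x y z|x y|c x y|r x y|x]; rewrite /mxdip.
- by rewrite -big_split; apply: eq_bigr => k _; exact: (ripD ipP).
- by apply: eq_bigr => k _; exact: (ripC ipP).
- by apply: eq_bigr => k _; exact: (rip_conj ipP).
- by rewrite mulr_sumr; apply: eq_bigr => k _; exact: (rip_real ipP).
- by rewrite sumr_ge0 // => k _; exact: (rip_ge0 ipP).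
Qed.

Lemma sqr_ipnorm_mxdip x : ipnorm mxdip x ^+ 2 = \sum_k hnorm (x k) ^+ 2.
Proof.
rewrite (sqr_ipnorm mxdip_inner_product).
by apply: eq_bigr => k _; rewrite sqr_hnorm.
Qed.

Lemma ipnorm_mxdip x : ipnorm mxdip x = Num.sqrt (\sum_k hnorm (x k) ^+ 2).
Proof.
by rewrite -sqr_ipnorm_mxdip sqrtr_sqr ger0_norm ?ipnorm_ge0.
Qed.

Lemma hnorm_le_mx x k : hnorm (x k) <= ipnorm mxdip x.
Proof.
rewrite -(@ler_pXn2r _ 2) ?nnegrE ?hnorm_ge0 ?ipnorm_ge0 // sqr_ipnorm_mxdip.
by rewrite (bigD1 k) //= lerDl sumr_ge0 // => l _; rewrite exprn_ge0 ?hnorm_ge0.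
Qed.

Lemma mx_le_sum x : ipnorm mxdip x <= \sum_k hnorm (x k).
Proof.
have s0 : 0 <= \sum_k hnorm (x k).
  by rewrite sumr_ge0 // => k _; exact: hnorm_ge0.
rewrite -(@ler_pXn2r _ 2) ?nnegrE ?ipnorm_ge0 // sqr_ipnorm_mxdip.
rewrite expr2 mulr_suml ler_sum // => k _.
rewrite expr2 ler_wpM2l ?hnorm_ge0 //.
by rewrite (bigD1 k) //= lerDl sumr_ge0 // => l _; exact: hnorm_ge0.
Qed.

Definition dcol l (x : dom) : domn := fun k => if k == l then x else 0.

Lemma ipnorm_dcol l (x : dom) : ipnorm mxdip (dcol l x) = hnorm x.
Proof.
rewrite ipnorm_mxdip (bigD1 l) //= /dcol eqxx big1 => [|k /negbTE->].
  by rewrite addr0 sqrtr_sqr ger0_norm ?hnorm_ge0.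
by rewrite hnorm0 expr0n.
Qed.

Lemma mxsubdom_dcol i l (x : dom) : subdom i x -> mxsubdom i (dcol l x).
Proof. by move=> xi k; rewrite /dcol; case: eqP => // _; exact: qd_sub0. Qed.

Lemma mxact_dcol X l (x : dom) k : mxact X (dcol l x) k = X k l x.
Proof.
rewrite /mxact (bigD1 l) //= /dcol eqxx big1 ?addr0 // => m /negbTE ->.
exact: cstarD_0E.
Qed.

Lemma mxsubdom_unit i : exists2 x, mxsubdom i x & ipnorm mxdip x != 0.
Proof.
have [x xi x0] := subdom_unit i; exists (dcol ord0 x).
  exact: mxsubdom_dcol.
by rewrite ipnorm_dcol -ipnorm_dip.
Qed.

Lemma mxsubdom_scale i (r : R) x : mxsubdom i x -> mxsubdom i (r%:C *: x).
Proof. by move=> xi l; exact: subdomZ. Qed.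

(** A crude bound that serves three times: it makes [mxact X] a bounded operator, it shows that the
    matrix seminorm vanishes when those of the entries do, and it bounds the sup norm of a matrix
    with bounded entries. *)
Lemma mxact_le_sum i X x : mxsubdom i x ->
  ipnorm mxdip (mxact X x) <=
  (\sum_k \sum_l cstarD_seminorm Q i (X k l)) * ipnorm mxdip x.
Proof.
move=> xi; apply: le_trans (mx_le_sum _) _; rewrite mulr_suml ler_sum // => k _.
apply: le_trans (hnorm_sum _) _; rewrite mulr_suml ler_sum // => l _.
apply: le_trans (cstarD_seminorm_ge _ (xi l)) _.
by rewrite ler_wpM2l ?cstarD_seminorm_ge0 // hnorm_le_mx.
Qed.

Lemma mxact_bounded i X : bounded_on mxdip (mxsubdom i) (mxact X).
Proof.
split=> [x xi k|r x|].
- by apply: subdom_sum => l; exact: cstarD_subdom.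
- apply/funext => k; rewrite /mxact.
  have -> : (r%:C *: (fun k => \sum_l X k l (x l))) k =
    r%:C *: (\sum_l X k l (x l)) by [].
  by rewrite scaler_sumr; apply: eq_bigr => l _; rewrite -cstarD_scaleE.
- by exists (\sum_k \sum_l cstarD_seminorm Q i (X k l)); exact: mxact_le_sum.
Qed.

Lemma cstarD_mxseminormE i X :
  cstarD_mxseminorm Q i n X = opnorm mxdip (mxsubdom i) (mxact X).
Proof.
have le1 x : (ipnorm mxdip x <= 1) = (\sum_l hnorm (x l) ^+ 2 <= 1).
  rewrite -(@ler_pXn2r _ 2) ?nnegrE ?ipnorm_ge0 ?ler01 //.
  by rewrite sqr_ipnorm_mxdip expr1n.
rewrite /cstarD_mxseminorm /opnorm; congr sup.
apply/seteqP; split=> _ [x [xi x1] <-]; exists x; rewrite ?ipnorm_mxdip //.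
  by split=> //; rewrite le1.
by split=> //; rewrite -le1.
Qed.

Lemma mxseminorm_ge i X x : mxsubdom i x ->
  ipnorm mxdip (mxact X x) <= cstarD_mxseminorm Q i n X * ipnorm mxdip x.
Proof.
rewrite cstarD_mxseminormE; apply: opnorm_ge.
- exact: mxdip_inner_product.
- exact: mxsubdom_scale.
- exact: mxact_bounded.
Qed.

Lemma mxseminorm_le i X (M : R) : 0 <= M ->
  (forall x, mxsubdom i x -> ipnorm mxdip (mxact X x) <= M * ipnorm mxdip x) ->
  cstarD_mxseminorm Q i n X <= M.
Proof.
move=> M0 XM; rewrite cstarD_mxseminormE; apply: opnorm_le => //.
- exact: mxdip_inner_product.
- exact: mxsubdom_scale.
- exact: mxsubdom_unit.
Qed.

Lemma mxseminorm_ge0 i X : 0 <= cstarD_mxseminorm Q i n X.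
Proof.
rewrite cstarD_mxseminormE; apply: opnorm_ge0.
- exact: mxdip_inner_product.
- exact: mxsubdom_scale.
- exact: mxsubdom_unit.
- exact: mxact_bounded.
Qed.

Lemma mxseminorm_le_sum i X :
  cstarD_mxseminorm Q i n X <= \sum_k \sum_l cstarD_seminorm Q i (X k l).
Proof.
apply: mxseminorm_le => [|x xi]; last exact: mxact_le_sum.
by do 2!(rewrite sumr_ge0 // => ? _); exact: cstarD_seminorm_ge0.
Qed.

Lemma entry_le_mxseminorm i X k l :
  cstarD_seminorm Q i (X k l) <= cstarD_mxseminorm Q i n X.
Proof.
apply: cstarD_seminorm_le => [|x xi]; first exact: mxseminorm_ge0.
rewrite -mxact_dcol -(ipnorm_dcol l x).
apply: le_trans (hnorm_le_mx _ _) _; exact/mxseminorm_ge/mxsubdom_dcol.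
Qed.

Lemma mxact_mul X Y x : mxact (X * Y) x = mxact X (mxact Y x).
Proof.
apply/funext => k; rewrite /mxact.
under eq_bigr => l _ do rewrite mxE cstarD_sumE.
rewrite exchange_big; apply: eq_bigr => m _ /=.
have : X k m (\sum_l Y m l (x l)) = \sum_l X k m (Y m l (x l)).
  apply: (big_morph (X k m)) => [a b|]; first exact: cstarD_addE.
  exact: cstarD_0E.
by move=> ->; apply: eq_bigr.
Qed.

Lemma mxact_adj X x y :
  mxdip (mxact X x) y = mxdip x (mxact (map_mx cstarD_adj X^T) y).
Proof.
have ipP := dip_inner_product.
rewrite /mxdip /mxact.
transitivity (\sum_k \sum_l dip (X k l (x l)) (y k)).
  apply: eq_bigr => k _.
  apply: (big_morph (fun a => dip a (y k))) => [a b|]; first exact: (ripD ipP).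
  by have := rip_real ipP 0 0 (y k); rewrite scale0r mul0r.
rewrite exchange_big; apply: eq_bigr => l _ /=.
transitivity (\sum_k dip (x l) (map_mx cstarD_adj X^T l k (y k))).
  by apply: eq_bigr => k _; rewrite !mxE cstarD_adjP.
apply/esym/(big_morph (dip (x l))) => [a b|]; first exact: (ipDr ipP).
by have := ipRr ipP 0 (x l) 0; rewrite scale0r mul0r.
Qed.

Lemma mxact_one x : mxact 1 x = x.
Proof.
apply/funext => k; rewrite /mxact (bigD1 k) //= mxE eqxx big1 ?addr0 //.
by move=> l; rewrite eq_sym => /negbTE lk; rewrite mxE lk.
Qed.

Lemma mxseminorm_Cstar i : Cstar_seminorm (fun c => map_mx ( *:%R c))
  (fun X => map_mx cstarD_adj X^T) (@cstarD_mxseminorm R H d Omega Q i n).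
Proof.
have ipP := mxdip_inner_product.
have Ks := @mxsubdom_scale i; have Ku := mxsubdom_unit i.
have Xb := @mxact_bounded i.
split=> [X Y|c X||X Y|X|X]; rewrite !cstarD_mxseminormE.
- apply: opnorm_triangle => // x; apply/funext => k.
  change (mxact (X + Y) x k = mxact X x k + mxact Y x k).
  by rewrite /mxact -big_split; apply: eq_bigr => l _; rewrite mxE.
- apply: opnorm_scale => // x; apply/funext => k.
  change (mxact (map_mx ( *:%R c) X) x k = c *: mxact X x k).
  by rewrite /mxact scaler_sumr; apply: eq_bigr => l _; rewrite mxE.
- rewrite -[RHS](opnorm_id ipP Ks Ku); congr opnorm.
  by apply/funext => x; exact: mxact_one.
- by apply: opnorm_mul => // x; exact: mxact_mul.
- by apply: opnorm_adj => // x y _ _; exact: mxact_adj.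
- apply: (@opnorm_Cstar _ _ _ ipP _ Ks Ku
    (mxact (map_mx cstarD_adj X^T))) => //.
    by move=> x y _ _; exact: mxact_adj.
  by move=> x; exact: mxact_mul.
Qed.

End MatrixNorm.

(** Index 0 means matrices of size 1. Through this identity the scalar C*-seminorm axioms, and later
    all scalar estimates for completely contractive maps, are read off from the matrix ones. *)
Lemma mxseminorm_scalar i (T : cstarD) :
  cstarD_mxseminorm Q i 0 (const_mx T) = cstarD_seminorm Q i T.
Proof.
apply/eqP; rewrite eq_le; apply/andP; split.
  apply: le_trans (mxseminorm_le_sum _ _) _.
  by rewrite !big_ord_recl !big_ord0 !addr0 mxE.
have := entry_le_mxseminorm i (const_mx T : 'M[cstarD]_1) ord0 ord0.
by rewrite mxE.
Qed.

Lemma cstarD_seminorm_Cstar i :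
  Cstar_seminorm *:%R cstarD_adj (cstarD_seminorm Q i).
Proof.
have E := mxseminorm_scalar i.
have P := @mxseminorm_Cstar 0 i.
split=> [S T|c T||S T|T|T]; rewrite -!E.
- apply: le_trans (csn_triangle P _ _); rewrite le_eqVlt; apply/orP; left.
  apply/eqP; congr (cstarD_mxseminorm _ _ _ _).
  by apply/matrixP => k l; rewrite !mxE.
- rewrite -(csn_scale P).
  by congr (cstarD_mxseminorm _ _ _ _); apply/matrixP => k l; rewrite !mxE.
- rewrite -[RHS](csn_one P); congr (cstarD_mxseminorm _ _ _ _).
  by apply/matrixP => k l; rewrite !ord1 !mxE.
- apply: le_trans (csn_mul P _ _); rewrite le_eqVlt; apply/orP; left.
  apply/eqP; congr (cstarD_mxseminorm _ _ _ _); apply/matrixP => k l.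
  by rewrite !mxE big_ord_recl big_ord0 addr0 !mxE.
- rewrite -[RHS](csn_star P).
  by congr (cstarD_mxseminorm _ _ _ _); apply/matrixP => k l; rewrite !mxE.
- rewrite -(csn_Cstar P); congr (cstarD_mxseminorm _ _ _ _).
  by apply/matrixP => k l; rewrite !mxE big_ord_recl big_ord0 addr0 !mxE.
Qed.

Lemma cstarD_seminormN i (T : cstarD) :
  cstarD_seminorm Q i (- T) = cstarD_seminorm Q i T.
Proof.
by rewrite -scaleN1r (csn_scale (cstarD_seminorm_Cstar i)) normrN normr1 mul1r.
Qed.

Lemma cstarD_seminorm_mono i j (T : cstarD) : (i <= j)%O ->
  cstarD_seminorm Q i T <= cstarD_seminorm Q j T.
Proof.
move=> ij; apply: cstarD_seminorm_le => [|x xi].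
  exact: cstarD_seminorm_ge0.
by apply: cstarD_seminorm_ge; exact: (qd_mono ij).
Qed.

Lemma cstarD_seminorm_eq0 i (T : cstarD) x :
  cstarD_seminorm Q i T = 0 -> subdom i x -> T x = 0.
Proof.
move=> T0 /(cstarD_seminorm_ge T); rewrite T0 mul0r => Tx.
by apply/val_inj/hnorm0_eq0/eqP; rewrite eq_le Tx hnorm_ge0.
Qed.

(** * Separation and completeness of C*(D_E) *)

Lemma cstarD_hausdorff (T : cstarD) :
  (forall i, cstarD_seminorm Q i T = 0) -> T = 0.
Proof.
move=> T0; apply: cstarD_ext => x; have [i xi] := subdom_ex x.
exact: (cstarD_seminorm_eq0 (T0 i)).
Qed.

(** The limit is built pointwise in [H]. It stays in the domain because a vector of [H_i] has all
    its images in the closed subspace [H_i], and the Cauchy estimates, uniform on the unit ball of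
    [H_i], survive the pointwise limit. *)
Lemma cstarD_complete (F : set_system cstarD) : ProperFilter F ->
  (forall i (e : R), 0 < e ->
    exists T, F [set S | cstarD_seminorm Q i (S - T) < e]) ->
  exists T, forall i (e : R), 0 < e ->
    F [set S | cstarD_seminorm Q i (S - T) < e].
Proof.
move=> FF Fc.
have close i (S T : cstarD) (e : R) (x : dom) : subdom i x ->
    cstarD_seminorm Q i (S - T) < e ->
    hnorm (dom_val (S x) - dom_val (T x)) <= e * hnorm x.
  move=> xi STe; apply: le_trans (cstarD_seminorm_ge (S - T) xi) _.
  by rewrite ler_wpM2r ?hnorm_ge0 // ltW.
have /choice[L LP] : forall x : dom, exists y : dom,
    hnorm_cvg F (fun S : cstarD => dom_val (S x)) y.
  move=> x; have [i xi] := subdom_ex x.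
  have [e e0|y yP] :=
    @hilbert_complete _ _ _ F (fun S : cstarD => dom_val (S x)) FF.
    (* The 1 allows division also when [x = 0]. *)
    have x1 : 0 < hnorm x + 1 by rewrite ltr_wpDl ?hnorm_ge0.
    have [T FT] := Fc i (e / (hnorm x + 1)) (divr_gt0 e0 x1).
    exists (T x); apply: filterS FT => S /(close _ _ _ _ _ xi).
    move/le_lt_trans; apply; rewrite mulrAC ltr_pdivrMr // ltr_pM2l //.
    by rewrite ltrDl.
  have yi : qd_sub Q i y.
    apply: (hilbert_closed FF (@qd_closed _ _ _ _ Q i) _ yP).
    by apply: filterE => S; exact: cstarD_subdom.
  by exists (dproj Q i y); rewrite /= proj_id.
have Llin : linear L.
  move=> c x y; apply: val_inj.
  apply: (hnorm_cvg_unique (LP (c *: x + y))).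
  have -> : (fun S : cstarD => dom_val (S (c *: x + y))) =
      (fun S : cstarD => c *: dom_val (S x) + dom_val (S y)).
    by apply/funext => S; rewrite cstarD_linear.
  exact: hnorm_cvg_linear.
have LPi i (x : dom) : dproj Q i (L x) = L (dproj Q i x).
  apply: val_inj; apply: esym; apply: (hnorm_cvg_unique (LP (dproj Q i x))).
  move=> e e0; apply: filterS (LP x _ e0) => S /=.
  apply: le_lt_trans; rewrite -cstarD_dproj /=.
  have -> : qd_proj Q i (S x) - qd_proj Q i (L x) =
      qd_proj Q i (dom_val (S x) - dom_val (L x)).
    have := proj_linear Q i (-1) (dom_val (L x)) (dom_val (S x)).
    rewrite !scaleN1r addrC => ->.
    by rewrite addrC.
  exact: hnorm_proj.
have Lclose i (T : cstarD) (e : R) : 0 < e ->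
    F [set S | cstarD_seminorm Q i (S - T) < e] -> forall x, subdom i x ->
    hnorm (dom_val (L x) - dom_val (T x)) <= e * hnorm x.
  move=> e0 FT x xi; apply: (hnorm_cvg_le (LP x)).
  by apply: filterS FT => S; exact: close.
have LD : L \in @cstarD_pred _ _ _ _ Q.
  apply/asboolP; split=> // i; split=> [x|x|]; first exact: LPi.
    by rewrite LPi dproj_id.
  (* On [H_i] the limit is within 1 of this [T], which bounds it. *)
  have [T FT] := Fc i 1 ltr01.
  exists (1 + cstarD_seminorm Q i T) => x; set y := dproj Q i x.
  have yi : subdom i y by exact: subdom_dproj.
  apply: (@le_trans _ _ ((1 + cstarD_seminorm Q i T) * hnorm y)); last first.
    by rewrite ler_wpM2l ?hnorm_proj // addr_ge0 ?cstarD_seminorm_ge0.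
  rewrite -[X in hnorm X](subrK (T y : H)) mulrDl.
  apply: le_trans (Defs.hnormD _ _) _; apply: lerD; first exact: Lclose FT _ yi.
  exact: cstarD_seminorm_ge.
exists (CstarD LD) => i e e0.
(* Two errors of [e / 3] leave room for the strict inequality, since the pointwise estimates are
   only weak ones. *)
have e3 : 0 < e / 3 by rewrite divr_gt0.
have [T FT] := Fc i _ e3; apply: filterS (FT) => S /= ST.
apply: (@le_lt_trans _ _ (e / 3 + e / 3)); last by lra.
apply: cstarD_seminorm_le => [|x xi]; first by rewrite addr_ge0 ?ltW.
change (hnorm (dom_val (S x) - dom_val (L x)) <= (e / 3 + e / 3) * hnorm x).
have -> : dom_val (S x) - dom_val (L x) =
    (dom_val (S x) - dom_val (T x)) - (dom_val (L x) - dom_val (T x)).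
  by rewrite opprB addrA subrK.
rewrite mulrDl; apply: le_trans (Defs.hnormD _ _) _; rewrite hnormN.
by apply: lerD; [exact: close ST | exact: Lclose FT _ xi].
Qed.

Lemma cstarD_locally_Cstar :
  locally_Cstar cstarD_adj (cstarD_seminorm Q) (cstarD_mxseminorm Q).
Proof.
split.
- exact: cstarD_adj_involution.
- exact: qd_directed Q.
- exact: cstarD_seminorm_Cstar.
- by move=> i j ij T; exact: cstarD_seminorm_mono.
- exact: cstarD_hausdorff.
- exact: cstarD_complete.
- move=> i n; split=> [|X]; first exact: mxseminorm_Cstar.
  split=> [X0 k l|X0].
    apply/eqP; rewrite eq_le cstarD_seminorm_ge0 andbT -X0.
    exact: entry_le_mxseminorm.
  apply/eqP; rewrite eq_le mxseminorm_ge0 andbT.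
  apply: le_trans (mxseminorm_le_sum _ _) _.
  by rewrite big1 // => k _; rewrite big1.
Qed.

(** * Bounded parts *)

Lemma bpartT (W : set cstarD) T : bpart W T -> bpart setT T.
Proof. by case. Qed.

Lemma unital_subspace_bpart (W : set cstarD) :
  unital_subspace W -> unital_subspace (bpart W).
Proof.
move=> [W1 Wlin]; split.
  split=> //; exists 1 => i.
  by rewrite (csn_one (cstarD_seminorm_Cstar i)).
move=> c S T [WS [M SM]] [WT [N TN]]; split; first exact: Wlin.
exists (complex.Re `|c| * M + N) => i.
apply: le_trans (csn_triangle (cstarD_seminorm_Cstar i) _ _) _.
rewrite (csn_scale (cstarD_seminorm_Cstar i)) lerD // ler_wpM2l //.
exact: Re_norm_ge0.
Qed.

(** A supremum dominates its members only when the set is bounded above, so bounds on the entries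
    are first combined into one valid for all seminorms. *)
Lemma bounded_mxnorm_ge n (X : 'M[cstarD]_n.+1) i : mx_in (bpart setT) X ->
  cstarD_mxseminorm Q i n X <= @bounded_mxnorm R H d Omega Q n X.
Proof.
move=> Xb; apply: ub_le_sup; last by exists i.
have /choice[M MP] : forall kl : 'I_n.+1 * 'I_n.+1, exists M : R,
    forall i, cstarD_seminorm Q i (X kl.1 kl.2) <= M.
  by move=> [k l]; have [_] := Xb k l.
exists (\sum_k \sum_l M (k, l)) => _ [j _ <-].
apply: le_trans (mxseminorm_le_sum _ _) _.
by apply: ler_sum => k _; apply: ler_sum => l _; exact: (MP (k, l)).
Qed.

Lemma bounded_mxnorm_le n (X : 'M[cstarD]_n.+1) (M : R) :
  (forall i, cstarD_mxseminorm Q i n X <= M) ->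
  @bounded_mxnorm R H d Omega Q n X <= M.
Proof.
move=> XM; apply: ge_sup; last by move=> _ [i _ <-].
by have [[i _] _] := qd_directed Q; exists (cstarD_mxseminorm Q i n X), i.
Qed.

Lemma completely_contractive_seminorm A (p : mxnorm A) i (W : set A)
    (phi : A -> cstarD) T :
  completely_contractive p (cstarD_mxseminorm Q i) W phi -> W T ->
  cstarD_seminorm Q i (phi T) <= p 0 (const_mx T).
Proof.
move=> pc WT; rewrite -mxseminorm_scalar -map_const_mx.
by apply: pc => k l; rewrite mxE.
Qed.

Lemma completely_isometric_seminorm (W : set cstarD) i
    (phi : cstarD -> cstarD) T :
  completely_isometric (cstarD_mxseminorm Q i) (cstarD_mxseminorm Q i) W phi ->
  W T -> cstarD_seminorm Q i (phi T) = cstarD_seminorm Q i T.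
Proof.
move=> iso WT; rewrite -!mxseminorm_scalar -map_const_mx.
by apply: iso => k l; rewrite mxE.
Qed.

Lemma local_isometry_bpart (V W : set cstarD) phi T :
  linear_between V W phi ->
  local_completely_isometric (cstarD_mxseminorm Q) (cstarD_mxseminorm Q)
    V phi ->
  bpart V T -> bpart W (phi T).
Proof.
move=> [phiW _] iso [VT [M TM]]; split; first exact: phiW.
by exists M => j; rewrite (completely_isometric_seminorm (iso j)).
Qed.

Lemma linear_between_sub (A B : algType R[i]) (V : set A) (W : set B) phi S T :
  linear_between V W phi -> V S -> V T -> phi (S - T) = phi S - phi T.
Proof.
move=> [_ lin] VS VT.
by rewrite addrC -scaleN1r lin // scaleN1r addrC.
Qed.

(** * Cutting down by the projections of a commutative domain *)

Section Commutative.
Hypothesis Q_comm : commutative_domain Q.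

(** Here commutativity of the domain enters: it puts [P_i] itself in C*(D_E), where it is central by
    [cprojC]. *)
Lemma cproj_subproof i :
  (fun x : dom => dproj Q i x) \in @cstarD_pred _ _ _ _ Q.
Proof.
have comm j (x : H) : dproj Q i (dproj Q j x) = dproj Q j (dproj Q i x).
  by apply: val_inj; exact: Q_comm.
apply/asboolP; split=> [c x y|j]; first by rewrite dproj_linear.
split=> [x|x|]; first by rewrite comm.
  by rewrite comm dproj_id.
exists 1 => x; rewrite mul1r.
exact: le_trans (hnorm_proj _ _ _) (hnorm_proj _ _ _).
Qed.

Definition cproj i : cstarD := CstarD (cproj_subproof i).

Lemma is_lmul_cproj i (T S : cstarD) :
  is_lmul (qd_proj Q i) T S -> S = cproj i * T.
Proof. by move=> TS; apply: cstarD_ext => x; apply: val_inj; exact: TS. Qed.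

Lemma cprojC i (T : cstarD) : cproj i * T = T * cproj i.
Proof. by apply: cstarD_ext => x; exact: cstarD_dproj. Qed.

Lemma cprojCA i j (T : cstarD) :
  cproj i * (cproj j * T) = cproj j * (cproj i * T).
Proof. by rewrite mulrA cprojC mulrA. Qed.

Lemma R_module_cproj (W : set cstarD) i T :
  R_module W -> W T -> W (cproj i * T).
Proof.
move=> [_ WR] /(WR _ _ (proj_ring_proj Q i))[S WS TS].
by rewrite -(is_lmul_cproj TS).
Qed.

Lemma R_map_cproj (W : set cstarD) phi i T : R_map W phi -> R_module W -> W T ->
  phi (cproj i * T) = cproj i * phi T.
Proof.
move=> phiR WR WT; apply: is_lmul_cproj.
by apply: phiR => //; exact: R_module_cproj.
Qed.

(** Centrality moves [P_i] from the entries to the vectors, where it lands in [H_i] without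
    increasing norms. So the [i]-th seminorm of [X] bounds every seminorm of the matrix cut down by
    [P_i]. *)
Lemma mxseminorm_cproj_le n i j (X : 'M[cstarD]_n.+1) :
  cstarD_mxseminorm Q j n (map_mx ( *%R (cproj i)) X) <=
  cstarD_mxseminorm Q i n X.
Proof.
apply: mxseminorm_le => [|x xj]; first exact: mxseminorm_ge0.
pose y l : dom := dproj Q i (x l).
have -> : mxact (map_mx ( *%R (cproj i)) X) x = mxact X y.
  by apply/funext => k; apply: eq_bigr => l _; rewrite mxE cprojC.
have yi : mxsubdom i y by move=> l; exact: subdom_dproj.
apply: le_trans (mxseminorm_ge X yi) _; rewrite ler_wpM2l ?mxseminorm_ge0 //.
rewrite -(@ler_pXn2r _ 2) ?nnegrE ?ipnorm_ge0 // !sqr_ipnorm_mxdip.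
by apply: ler_sum => l _; rewrite ler_pXn2r ?nnegrE ?hnorm_ge0 // hnorm_proj.
Qed.

Lemma mxseminorm_cproj n i (X : 'M[cstarD]_n.+1) :
  cstarD_mxseminorm Q i n (map_mx ( *%R (cproj i)) X) =
  cstarD_mxseminorm Q i n X.
Proof.
apply/eqP; rewrite eq_le mxseminorm_cproj_le /=.
apply: mxseminorm_le => [|x xi]; first exact: mxseminorm_ge0.
have -> : mxact X x = mxact (map_mx ( *%R (cproj i)) X) x.
  apply/funext => k; apply: eq_bigr => l _; rewrite mxE.
  change (X k l (x l) = dproj Q i (X k l (x l))).
  by rewrite dproj_sub //; apply: cstarD_subdom; exact: xi.
exact: mxseminorm_ge.
Qed.

Lemma seminorm_cproj_le i j (T : cstarD) :
  cstarD_seminorm Q j (cproj i * T) <= cstarD_seminorm Q i T.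
Proof.
by have := mxseminorm_cproj_le i j (const_mx T : 'M[cstarD]_1);
  rewrite map_const_mx !mxseminorm_scalar.
Qed.

(** The bounded elements [P_j T] approximate [T] in a strong sense: for each seminorm the error is
    exactly 0 once [j] is large. *)
Lemma seminorm_cproj_sub i j (T : cstarD) : (i <= j)%O ->
  cstarD_seminorm Q i (T - cproj j * T) = 0.
Proof.
move=> ij; apply/eqP; rewrite eq_le cstarD_seminorm_ge0 andbT.
apply: cstarD_seminorm_le => // x xi; rewrite mul0r.
change (hnorm (T x - dproj Q j (T x) : dom) <= 0).
rewrite dproj_sub ?subrr ?hnorm0 //.
by apply: cstarD_subdom; exact: (qd_mono ij).
Qed.

Lemma bpart_cproj (W : set cstarD) i T :
  R_module W -> W T -> bpart W (cproj i * T).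
Proof.
move=> WR WT; split; first exact: R_module_cproj.
by exists (cstarD_seminorm Q i T) => j; exact: seminorm_cproj_le.
Qed.

Lemma R_module_bpart (W : set cstarD) : R_module W -> R_module (bpart W).
Proof.
move=> WR; split; first by apply: unital_subspace_bpart; case: WR.
move=> r T rR [WT [M TM]].
have [S WS TS] := WR.2 _ _ rR WT; exists S => //; split=> //.
(* By induction on its generation, each element of the ring is a bounded operator on [H]. *)
have [c c0 rc] : exists2 c : R, 0 <= c &
    forall x : H, hnorm (r x) <= c * hnorm x.
  elim: rR {TS S WS} => [|i|s t _ [a a0 sa] _ [b b0 tb]
                        |s t _ [a a0 sa] _ [b b0 tb]].
  - by exists 1 => // x; rewrite mul1r.
  - by exists 1 => // x; rewrite mul1r hnorm_proj.
  - exists (a + b); first exact: addr_ge0.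
    move=> x; apply: le_trans (Defs.hnormD _ _) _.
    by rewrite hnormN mulrDl lerD.
  - exists (a * b); first exact: mulr_ge0.
    move=> x; apply: le_trans (sa _) _.
    by rewrite -mulrA ler_wpM2l.
have M0 : 0 <= M.
  have [[i _] _] := qd_directed Q.
  exact: le_trans (cstarD_seminorm_ge0 i T) (TM i).
exists (c * M) => i; apply: cstarD_seminorm_le => [|x xi].
  exact: mulr_ge0.
rewrite TS; apply: le_trans (rc _) _; rewrite -mulrA ler_wpM2l //.
apply: le_trans (cstarD_seminorm_ge T xi) _.
by rewrite ler_wpM2r ?hnorm_ge0.
Qed.

(* Cutting down by P_i, which an R-map commutes with, turns the sup norm into
   the i-th seminorm. *)
Lemma R_map_completely_contractive (W : set cstarD) phi i : R_module W ->
  linear_between (bpart W) (bpart W) phi ->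
  completely_contractive (@bounded_mxnorm R H d Omega Q)
    (@bounded_mxnorm R H d Omega Q) (bpart W) phi ->
  R_map (bpart W) phi ->
  completely_contractive (cstarD_mxseminorm Q i) (cstarD_mxseminorm Q i)
    (bpart W) phi.
Proof.
move=> WR [phiW _] phic phiR n X Xb.
have bWR := R_module_bpart WR.
rewrite -mxseminorm_cproj -map_mx_comp.
have -> : map_mx ( *%R (cproj i) \o phi) X =
    map_mx phi (map_mx ( *%R (cproj i)) X).
  apply/matrixP => k l; rewrite !mxE /=; apply/esym.
  by apply: (R_map_cproj i phiR bWR); exact: Xb.
have PXb : mx_in (bpart W) (map_mx ( *%R (cproj i)) X).
  by move=> k l; rewrite mxE; apply: bpart_cproj => //; case: (Xb k l).
apply: le_trans (bounded_mxnorm_ge _ _) _.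
  by move=> k l; rewrite mxE; exact/(@bpartT W)/phiW.
apply: le_trans (phic _ _ PXb) _; apply: bounded_mxnorm_le => j.
exact: mxseminorm_cproj_le.
Qed.

(** Local contractivity makes [psi U] and [psi (P_k U)] agree on [H_j] for large [k], and [P_k U] is
    bounded, so the identity on [bpart W] carries over. *)
Lemma R_map_of_bpart (W : set cstarD) psi : R_module W ->
  linear_between W W psi ->
  local_completely_contractive (cstarD_mxseminorm Q) (cstarD_mxseminorm Q)
    W psi ->
  R_map (bpart W) psi -> R_map W psi.
Proof.
move=> WR psilin psic psiR i T S WT WS /is_lmul_cproj SE.
suff -> : psi S = cproj i * psi T by [].
apply/eqP; rewrite -subr_eq0; apply/eqP/cstarD_hausdorff => j.
have [l psil] := psic j.
(* With [k] above [l], [U - P_k U] has zero [l]-th seminorm, which dominates the [j]-th seminorm of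
   its image under [psi]. *)
have [_ /(_ l j)[k [lk jk]]] := qd_directed Q.
have [W0 Wlin] := WR.1.
have near U : W U ->
    cstarD_seminorm Q j (psi U - psi (cproj k * U)) = 0.
  move=> WU; have WkU := R_module_cproj k WR WU.
  rewrite -(linear_between_sub psilin) //.
  apply/eqP; rewrite eq_le cstarD_seminorm_ge0 andbT.
  have WD : W (U - cproj k * U) by rewrite addrC -scaleN1r; exact: Wlin.
  apply: le_trans (completely_contractive_seminorm psil WD) _.
  by rewrite mxseminorm_scalar seminorm_cproj_sub.
have bR := R_module_bpart WR.
have psik : psi (cproj k * S) = cproj i * psi (cproj k * T).
  rewrite SE cprojCA.
  by apply: (R_map_cproj i psiR bR); exact: bpart_cproj.
apply/eqP; rewrite eq_le cstarD_seminorm_ge0 andbT.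
apply: cstarD_seminorm_le => // x xj; rewrite mul0r.
have ev U : W U -> psi U x = psi (cproj k * U) x.
  move=> /near/cstarD_seminorm_eq0/(_ xj) => E.
  by apply/eqP; rewrite -subr_eq0; apply/eqP.
change (hnorm (psi S x - dproj Q i (psi T x) : dom) <= 0).
rewrite ev // psik (ev T) //.
change (hnorm (dproj Q i (psi (cproj k * T) x) -
  dproj Q i (psi (cproj k * T) x) : dom) <= 0).
by rewrite subrr hnorm0.
Qed.

Lemma bpart_R_rigid (V W : set cstarD) (i : cstarD -> cstarD) :
  unital_subspace V -> seminorm_closure (cstarD_seminorm Q) (bpart V) = V ->
  local_injective_R_envelope V W i -> R_rigid (bpart V) (bpart W) i.
Proof.
move=> [V1 Vlin] Vcl [[WR ilin i1 iiso] rigid Winj] phi philin phic phiR phii.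
have bV1 : bpart V 1 by have [] := @unital_subspace_bpart V.
have bWlc : local_completely_contractive (cstarD_mxseminorm Q)
    (cstarD_mxseminorm Q) (bpart W) phi.
  by move=> j; exists j; exact: R_map_completely_contractive.
have philin' : linear_between (bpart W) W phi.
  by split=> [T bT|]; [have [] := philin.1 T bT | exact: philin.2].
(* [R_rigid] does not assume [phi] unital, but [1 = i 1] lies in the copy of [bpart V], which [phi]
   fixes. *)
have phi1 : phi 1 = 1 by rewrite -{1}i1 phii.
have [|psi [psilin psi1 psic psiphi]] := Winj _ _ _ _ _ _ cstarD_locally_Cstar
  (bpart W) W (unital_subspace_bpart WR.1) WR.1 _ phi philin' phi1 bWlc.
  by move=> T [].
suff psi_id T : W T -> psi T = T.
  by move=> T bT; rewrite -psiphi // psi_id //; case: bT.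
apply: rigid => //.
  apply: R_map_of_bpart => // k S S' bS bS' SS'.
  by rewrite !psiphi //; exact: phiR.
move=> {}T VT; apply/eqP; rewrite -subr_eq0; apply/eqP/cstarD_hausdorff => j.
apply/eqP; rewrite eq_le cstarD_seminorm_ge0 andbT.
apply/ler_addgt0Pr => e e0; rewrite add0r.
have [l psil] := psic j.
(* The approximation of [T] is made in a seminorm above both [l], which controls [psi (i (T - T'))],
   and [j], which controls [i (T - T')]; each term receives [e / 2]. *)
have [_ /(_ l j)[k [lk jk]]] := qd_directed Q.
have [T' bT' TT'] : exists2 T',
    bpart V T' & cstarD_seminorm Q k (T - T') < e / 2.
  have : seminorm_closure (cstarD_seminorm Q) (bpart V) T by rewrite Vcl.
  by apply; rewrite divr_gt0.
have VT' : V T' by case: bT'.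
have VD : V (T - T') by rewrite addrC -scaleN1r; exact: Vlin.
have WD : W (i (T - T')) by exact: ilin.1.
have pi m : (m <= k)%O -> cstarD_seminorm Q m (i (T - T')) < e / 2.
  move=> mk; apply: le_lt_trans TT'.
  apply: le_trans (cstarD_seminorm_mono _ mk).
  by rewrite (completely_isometric_seminorm (iiso m)).
(* As [psi] fixes [i T'], only the small difference [T - T'] remains. *)
have -> : psi (i T) - i T = psi (i (T - T')) - i (T - T').
  rewrite (linear_between_sub ilin) // (linear_between_sub psilin);
    [|exact: ilin.1|exact: ilin.1].
  have -> : psi (i T') = i T'.
    by rewrite psiphi ?phii //; exact: local_isometry_bpart ilin iiso bT'.
  by rewrite opprB addrA subrK.
apply: le_trans (csn_triangle (cstarD_seminorm_Cstar j) _ _) _.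
rewrite cstarD_seminormN [leRHS]splitr; apply: lerD; last exact/ltW/pi.
apply: le_trans (completely_contractive_seminorm psil WD) _.
by rewrite mxseminorm_scalar; exact/ltW/pi.
Qed.

End Commutative.

(** A C*-algebra is a locally C*-algebra with one seminorm, so the extension given by [W] is
    contractive from that single norm into every seminorm. Its values are therefore bounded
    uniformly in [j], hence in [bpart W]. *)
Lemma bpart_injective (W : set cstarD) :
  injective_local_operator_space (cstarD_mxseminorm Q) W ->
  injective_operator_space (@bounded_mxnorm R H d Omega Q) (bpart W).
Proof.
move=> Winj B star p pn BC W0 W1 W0u W1u W01 phi philin phi1 phic.
have philin' : linear_between W0 W phi.
  by split=> [a /(philin.1 a)[]|]; last exact: philin.2.
have philc : local_completely_contractive (fun _ : 'I_1 => pn)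
    (cstarD_mxseminorm Q) W0 phi.
  move=> j; exists ord0 => n X X0; apply: le_trans (phic _ _ X0).
  apply: bounded_mxnorm_ge => k l; rewrite mxE.
  exact/(@bpartT W)/philin.1/X0.
have [psi [psilin psi1 psic psiphi]] :=
  Winj _ _ _ _ _ _ BC W0 W1 W0u W1u W01 phi philin' phi1 philc.
have psic' j : completely_contractive pn (cstarD_mxseminorm Q j) W1 psi.
  by have [l] := psic j.
exists psi; split=> //.
  split=> [a W1a|]; last exact: psilin.2.
  split; first exact: psilin.1.
  by exists (pn 0 (const_mx a)) => j;
    exact: completely_contractive_seminorm (psic' j) W1a.
by move=> n X X1; apply: bounded_mxnorm_le => j; exact: psic'.
Qed.

End CstarD.

Theorem proposition4p9 (R : realType) (H : hilbert_space R)
    (d : Order.disp_t) (Omega : porderType d) (Q : quantized_domain H Omega)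
    (Q_comm : commutative_domain Q)
    (Q_inj : injective_local_operator_space (cstarD_mxseminorm Q) setT)
    (V : set (cstarD Q)) (V_unital : unital_subspace V)
    (V_closure : seminorm_closure (cstarD_seminorm Q) (bpart V) = V)
    (W : set (cstarD Q)) (i : cstarD Q -> cstarD Q)
    (W_envelope : local_injective_R_envelope V W i) :
  exists (U : set (cstarD Q)) (j : cstarD Q -> cstarD Q),
    injective_R_envelope (bpart V) U j /\
    exists phi : cstarD Q -> cstarD Q,
      unital_complete_order_R_isomorphism (bpart W) U phi /\
      forall T, bpart V T -> phi (i T) = j T.
Proof.
have [[WR ilin i1 iiso] _ Winj] := W_envelope.
(* The bounded part serves as the envelope with the same embedding, so the isomorphism is the
   identity. *)
exists (bpart W), i; split; last first.
  have idP : complete_isometric_R_map (bpart W) (bpart W) id.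
    by split=> // n X _; rewrite map_mx_id.
  by exists id; split=> //; split=> //; split=> //; exists id.
split.
- split=> //.
  + by move=> T; exact: bpartT.
  + exact: R_module_bpart.
  + split=> [T bT|c S T [VS _] [VT _]]; last exact: ilin.2.
    exact: local_isometry_bpart ilin iiso bT.
  (* The embedding preserves each seminorm, so both suprema are taken over the same set. *)
  + move=> n X Xb; congr sup; apply/seteqP.
    have E l : cstarD_mxseminorm Q l n (map_mx i X) = cstarD_mxseminorm Q l n X.
      by apply: iiso => a b; have [] := Xb a b.
    by split=> _ [l _ <-]; exists l.
- exact: bpart_R_rigid V_unital V_closure W_envelope.
- exact: bpart_injective.
Qed.
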